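(* Let $\mathcal E$ be a symmetric monoidal category. The weak indexed enrichments of $FI$ with values in $\mathcal E$, i.e. the weak enrichment functors $\mathcal D$ for the Feynman category $\mathfrak{Inj}$ of finite sets and injections, are in one-to-one correspondence (up to equivalence) with pairs $(A,M)$ where $A$ is a unital associative algebra (monoid) in $\mathcal E$ and $M$ is an $A$-module in $\mathcal E$.
   Context: $\mathfrak{Inj}=(\underline 1,FI,\imath)$, where $FI$ is the category of finite sets and injections with disjoint union as symmetric monoidal product, $\underline 1$ is the trivial groupoid with one object $*$, and $\imath( * )=\{*\}$. Write $\mathrm{Iso}(FI\downarrow FI)$ for the groupoid of isomorphisms of the arrow category, whose morphisms are written $(\sigma\Downarrow\sigma'):\phi\to\sigma'\circ\phi\circ\sigma^{-1}$. In this context $\mathcal E$ is enriched over itself and has coproducts. Weak enrichment functor for $\mathcal F=FI$ with values in $\mathcal E$: a strictly (symmetric) monoidal, horizontally lax functor from the double category of $\mathcal F$ (isomorphisms vertically, all morphisms horizontally, commutative squares as 2-morphisms) to $(\mathcal E,\otimes)$ viewed as a one-object double category. Explicitly: (1) a functor $\mathcal D:\mathrm{Iso}(\mathcal F\downarrow\mathcal F)\to\mathcal E$, strictly monoidal (taking disjoint union of morphisms to $\otimes$, up to equivalence); (2) for each composable pair, morphisms $\mathcal D(\phi_0)\otimes\mathcal D(\phi_1)\to\mathcal D(\phi_0\circ\phi_1)$, associative, natural with respect to $(\sigma\Downarrow\sigma')$ and compatible with the monoidal products via interchange; (3) for each object $X$ a morphism $\mathbf 1_{\mathcal E}\to\mathcal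 D(\mathrm{id}_X)$, natural in isomorphisms of $X$, monoidal, and a two-sided unit for (2). Weak enrichment functors define weak indexed enrichments of $\mathfrak{Inj}$ by $\mathrm{Hom}(X,Y)=\bigoplus_{\phi:X\to Y}\mathcal D(\phi)$. *)

(* Defs.v *)
From HB Require Import structures.
From mathcomp Require Import all_boot.
From Stdlib Require Import ProofIrrelevance.

Set Implicit Arguments.
Unset Strict Implicit.
Unset Printing Implicit Defensive.

Declare Scope cat_scope.
Delimit Scope cat_scope with cat.
Local Open Scope cat_scope.

(** * Categories *)

Record category := Category {
  ob :> Type;
  hom : ob -> ob -> Type;
  idm : forall x, hom x x;
  cmp : forall x y z, hom y z -> hom x y -> hom x z;
  cmpA : forall x y z t (h : hom z t) (g : hom y z) (f : hom x y),
    cmp h (cmp g f) = cmp (cmp h g) f;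
  cmp1m : forall x y (f : hom x y), cmp (idm y) f = f;
  cmpm1 : forall x y (f : hom x y), cmp f (idm x) = f
}.
Arguments hom {c} x y.
Arguments idm {c} x.
Arguments cmp {c x y z} g f.

Notation "g \oc f" := (cmp g f) (at level 50, left associativity) : cat_scope.

Record iso (C : category) (x y : C) := Iso {
  fwd :> hom x y;
  bwd : hom y x;
  isoK : bwd \oc fwd = idm x;
  isoVK : fwd \oc bwd = idm y
}.
Arguments fwd {C x y} i.
Arguments bwd {C x y} i.

Section IsoTheory.
Context {C : category}.

Lemma iso_eq (x y : C) (f g : iso x y) : fwd f = fwd g -> f = g.
Proof.
case: f g => [f f' fK fVK] [g g' gK gVK] /= efg; subst g.
have e : f' = g' by rewrite -[f']cmpm1 -gVK cmpA fK cmp1m.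
by subst g'; rewrite (proof_irrelevance _ gK fK) (proof_irrelevance _ gVK fVK).
Qed.

Definition iso_id (x : C) : iso x x := Iso (cmp1m (idm x)) (cmp1m (idm x)).

Definition iso_inv (x y : C) (f : iso x y) : iso y x := Iso (isoVK f) (isoK f).

Lemma cmp_can (x y z : C) (f : hom x y) (f' : hom y x) (g : hom y z)
    (g' : hom z y) :
  f' \oc f = idm x -> g' \oc g = idm y -> (f' \oc g') \oc (g \oc f) = idm x.
Proof. by move=> fK gK; rewrite -cmpA [g' \oc (g \oc f)]cmpA gK cmp1m. Qed.

Definition iso_cmp (x y z : C) (g : iso y z) (f : iso x y) : iso x z :=
  Iso (cmp_can (isoK f) (isoK g)) (cmp_can (isoVK g) (isoVK f)).

End IsoTheory.

(** * Symmetric monoidal categories and strong symmetric monoidal functors *)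

Record sym_mon_cat := SymMonCat {
  smc_cat :> category;
  tens : smc_cat -> smc_cat -> smc_cat;
  tensm : forall x x' y y' : smc_cat,
    hom x x' -> hom y y' -> hom (tens x y) (tens x' y');
  one : smc_cat;
  assoc : forall x y z, iso (tens (tens x y) z) (tens x (tens y z));
  lunit : forall x, iso (tens one x) x;
  runit : forall x, iso (tens x one) x;
  braid : forall x y, iso (tens x y) (tens y x);
  tensm1 : forall x y, tensm (idm x) (idm y) = idm (tens x y);
  tensmM : forall x x' x'' y y' y'' (g : hom x' x'') (f : hom x x')
      (k : hom y' y'') (h : hom y y'),
    tensm (g \oc f) (k \oc h) = tensm g k \oc tensm f h;
  assoc_nat : forall x x' y y' z z' (f : hom x x') (g : hom y y')
      (h : hom z z'),
    assoc x' y' z' \oc tensm (tensm f g) h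
    = tensm f (tensm g h) \oc assoc x y z;
  lunit_nat : forall x x' (f : hom x x'),
    lunit x' \oc tensm (idm one) f = f \oc lunit x;
  runit_nat : forall x x' (f : hom x x'),
    runit x' \oc tensm f (idm one) = f \oc runit x;
  braid_nat : forall x x' y y' (f : hom x x') (g : hom y y'),
    braid x' y' \oc tensm f g = tensm g f \oc braid x y;
  pentagon : forall x y z t,
    tensm (idm x) (assoc y z t)
      \oc (assoc x (tens y z) t \oc tensm (assoc x y z) (idm t))
    = assoc x y (tens z t) \oc assoc (tens x y) z t;
  triangle : forall x y,
    tensm (idm x) (lunit y) \oc assoc x one y = tensm (runit x) (idm y);
  hexagon : forall x y z,
    assoc y z x \oc (braid x (tens y z) \oc assoc x y z)
    = tensm (idm y) (braid x z)
        \oc (assoc y x z \oc tensm (braid x y) (idm z));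
  braidK : forall x y, braid y x \oc braid x y = idm (tens x y)
}.
Arguments tens {s} x y.
Arguments tensm {s x x' y y'} f g.
Arguments one {s}.
Arguments assoc {s} x y z.
Arguments lunit {s} x.
Arguments runit {s} x.
Arguments braid {s} x y.

Notation "x \ox y" := (tens x y) (at level 40, left associativity) : cat_scope.
Notation "f \om g" := (tensm f g) (at level 40, left associativity) : cat_scope.

Definition iso_tens (C : sym_mon_cat) (x x' y y' : C)
  (f : iso x x') (g : iso y y') : iso (x \ox y) (x' \ox y').
Proof.
apply: (@Iso _ _ _ (f \om g) (bwd f \om bwd g));
  abstract by rewrite -tensmM ?isoK ?isoVK tensm1.
Defined.

(* (a b)(c d) -> a(b(c d)) -> a((b c)d) -> a((c b)d) -> a(c(b d)) -> (a c)(b d) *)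
Definition middle_four (C : sym_mon_cat) (a b c d : C) :
    hom ((a \ox b) \ox (c \ox d)) ((a \ox c) \ox (b \ox d)) :=
  bwd (assoc a c (b \ox d))
  \oc (idm a \om (assoc c b d \oc (braid b c \om idm d) \oc bwd (assoc b c d)))
  \oc assoc a b (c \ox d).

Record strong_functor (C E : sym_mon_cat) := StrongFunctor {
  fob :> C -> E;
  fmap : forall x y : C, hom x y -> hom (fob x) (fob y);
  ften : forall x y : C, iso (fob x \ox fob y) (fob (x \ox y));
  fone : iso one (fob one);
  fmap1 : forall x, fmap (idm x) = idm (fob x);
  fmapM : forall x y z (g : hom y z) (f : hom x y),
    fmap (g \oc f) = fmap g \oc fmap f;
  ften_nat : forall x x' y y' (f : hom x x') (g : hom y y'),
    ften x' y' \oc (fmap f \om fmap g) = fmap (f \om g) \oc ften x y;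
  fassoc : forall x y z,
    fmap (assoc x y z) \oc (ften (x \ox y) z \oc (ften x y \om idm (fob z)))
    = ften x (y \ox z) \oc (idm (fob x) \om ften y z)
        \oc assoc (fob x) (fob y) (fob z);
  flunit : forall x,
    fmap (lunit x) \oc (ften one x \oc (fone \om idm (fob x)))
    = lunit (fob x);
  frunit : forall x,
    fmap (runit x) \oc (ften x one \oc (idm (fob x) \om fone))
    = runit (fob x);
  fbraid : forall x y,
    fmap (braid x y) \oc ften x y = ften y x \oc braid (fob x) (fob y)
}.
Arguments fmap {C E} s {x y} f.
Arguments ften {C E} s x y.
Arguments fone {C E} s.

(** * The groupoid of isomorphisms of the arrow category *)

Record arrow (C : category) := Arrow { src : C; tgt : C; arr : hom src tgt }.
Arguments Arrow {C src tgt} arr.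

(* The morphism written (s, s') below, from phi to psi; the equation says that
   psi = s' \oc phi \oc s^-1. *)
Record square (C : category) (phi psi : arrow C) := Square {
  sq_src : iso (src phi) (src psi);
  sq_tgt : iso (tgt phi) (tgt psi);
  squareE : sq_tgt \oc arr phi = arr psi \oc sq_src
}.
Arguments Square {C phi psi} sq_src sq_tgt squareE.

Section IsoArrow.
Context {C : category}.

Lemma square_eq (phi psi : arrow C) (s t : square phi psi) :
  fwd (sq_src s) = fwd (sq_src t) -> fwd (sq_tgt s) = fwd (sq_tgt t) -> s = t.
Proof.
case: s t => [s s' es] [t t' et] /= /iso_eq e /iso_eq e'.
by subst t t'; rewrite (proof_irrelevance _ es et).
Qed.

Lemma square_id_subproof (phi : arrow C) :
  iso_id (tgt phi) \oc arr phi = arr phi \oc iso_id (src phi).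
Proof. by rewrite /= cmp1m cmpm1. Qed.

Definition square_id (phi : arrow C) : square phi phi :=
  Square _ _ (square_id_subproof phi).

Lemma square_cmp_subproof (phi psi chi : arrow C) (t : square psi chi)
    (s : square phi psi) :
  iso_cmp (sq_tgt t) (sq_tgt s) \oc arr phi
  = arr chi \oc iso_cmp (sq_src t) (sq_src s).
Proof. by rewrite /= -cmpA squareE cmpA squareE cmpA. Qed.

Definition square_cmp (phi psi chi : arrow C) (t : square psi chi)
    (s : square phi psi) : square phi chi :=
  Square _ _ (square_cmp_subproof t s).

Lemma square_inv_subproof (phi psi : arrow C) (s : square phi psi) :
  iso_inv (sq_tgt s) \oc arr psi = arr phi \oc iso_inv (sq_src s).
Proof.
rewrite /= -[arr psi]cmpm1 -(isoVK (sq_src s)) [arr psi \oc _]cmpA -squareE.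
by rewrite !cmpA isoK cmp1m.
Qed.

Definition square_inv (phi psi : arrow C) (s : square phi psi) :
  square psi phi := Square _ _ (square_inv_subproof s).

Definition iso_arrow : category.
Proof.
apply: (@Category (arrow C) (@square C) square_id square_cmp);
  abstract by move=> *; apply: square_eq => /=; rewrite ?cmpA ?cmp1m ?cmpm1.
Defined.

Definition iso_square (phi psi : iso_arrow) (s : hom phi psi) : iso phi psi.
Proof.
apply: (@Iso iso_arrow _ _ s (square_inv s));
  abstract by apply: square_eq; rewrite /= ?isoK ?isoVK.
Defined.

Lemma square_cast_subproof (x y : C) (f g : hom x y) : f = g ->
  iso_id y \oc f = g \oc iso_id x.
Proof. by move=> ->; rewrite /= cmp1m cmpm1. Qed.

Definition square_of (x y x' y' : C) (f : hom x y) (f' : hom x' y')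
    (s : iso x x') (s' : iso y y') (e : s' \oc f = f' \oc s) :
    @hom iso_arrow (Arrow f) (Arrow f') :=
  @Square C (Arrow f) (Arrow f') s s' e.

(* The identity morphism (id, id) between two equal arrows. *)
Definition square_cast (x y : C) (f g : hom x y) (e : f = g) :
    @hom iso_arrow (Arrow f) (Arrow g) :=
  square_of (square_cast_subproof e).

End IsoArrow.
Arguments iso_arrow : clear implicits.

Section IsoArrowMonoidal.
Context {C : sym_mon_cat}.

Definition arrow_tens (phi psi : arrow C) : arrow C :=
  Arrow (arr phi \om arr psi).

Lemma square_tens_subproof (phi phi' psi psi' : arrow C)
    (s : square phi phi') (t : square psi psi') :
  iso_tens (sq_tgt s) (sq_tgt t) \oc (arr phi \om arr psi)
  = (arr phi' \om arr psi') \oc iso_tens (sq_src s) (sq_src t).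
Proof. by rewrite /= -!tensmM !squareE. Qed.

Definition square_tens (phi phi' psi psi' : arrow C)
    (s : square phi phi') (t : square psi psi') :
    square (arrow_tens phi psi) (arrow_tens phi' psi') :=
  @Square C (arrow_tens phi psi) (arrow_tens phi' psi') _ _
    (square_tens_subproof s t).

Definition arrow_one : arrow C := Arrow (idm one).

Definition square_assoc (phi psi chi : arrow C) :
    square (arrow_tens (arrow_tens phi psi) chi)
           (arrow_tens phi (arrow_tens psi chi)) :=
  @Square C (arrow_tens (arrow_tens phi psi) chi)
    (arrow_tens phi (arrow_tens psi chi)) (assoc _ _ _) (assoc _ _ _)
    (assoc_nat (arr phi) (arr psi) (arr chi)).

Definition square_lunit (phi : arrow C) :
    square (arrow_tens arrow_one phi) phi :=
  @Square C (arrow_tens arrow_one phi) phi (lunit _) (lunit _)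
    (lunit_nat (arr phi)).

Definition square_runit (phi : arrow C) :
    square (arrow_tens phi arrow_one) phi :=
  @Square C (arrow_tens phi arrow_one) phi (runit _) (runit _)
    (runit_nat (arr phi)).

Definition square_braid (phi psi : arrow C) :
    square (arrow_tens phi psi) (arrow_tens psi phi) :=
  @Square C (arrow_tens phi psi) (arrow_tens psi phi) (braid _ _) (braid _ _)
    (braid_nat (arr phi) (arr psi)).

Definition iso_arrow_smc : sym_mon_cat.
Proof.
apply: (@SymMonCat (iso_arrow C) arrow_tens square_tens arrow_one
  (fun phi psi chi => @iso_square C _ _ (square_assoc phi psi chi))
  (fun phi => @iso_square C _ _ (square_lunit phi))
  (fun phi => @iso_square C _ _ (square_runit phi))
  (fun phi psi => @iso_square C _ _ (square_braid phi psi)));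
  abstract by move=> *; apply: square_eq => /=;
  first [exact: tensm1 | exact: tensmM | exact: assoc_nat | exact: lunit_nat
     | exact: runit_nat | exact: braid_nat | exact: pentagon | exact: triangle
     | exact: hexagon | exact: braidK].
Defined.

End IsoArrowMonoidal.
Arguments iso_arrow_smc : clear implicits.

(** * Weak enrichment functors *)

Section WeakEnrichment.
Context {F E : sym_mon_cat}.

Section Laws.
Variable D : strong_functor (iso_arrow_smc F) E.

Local Notation "'D_' f" := (fob D (Arrow f)) (at level 9, f at level 9).

Definition comp_data := forall (X Y Z : F) (g : hom Y Z) (f : hom X Y),
  hom (D_ g \ox D_ f) (D_ (g \oc f)).

Definition unit_data := forall X : F, hom one (D_ (idm X)).

Variables (c : comp_data) (u : unit_data).

Definition fmapD (X Y X' Y' : F) (f : hom X Y) (f' : hom X' Y')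
    (s : iso X X') (s' : iso Y Y') (e : s' \oc f = f' \oc s) :
    hom (D_ f) (D_ f') :=
  @fmap _ _ D (Arrow f) (Arrow f') (square_of e).

Definition castD (X Y : F) (f g : hom X Y) (e : f = g) : hom (D_ f) (D_ g) :=
  @fmap _ _ D (Arrow f) (Arrow g) (square_cast e).

Definition comp_associative := forall (X Y Z W : F)
    (h : hom Z W) (g : hom Y Z) (f : hom X Y),
  c h (g \oc f) \oc (idm (D_ h) \om c g f)
    \oc assoc (D_ h) (D_ g) (D_ f)
  = castD (esym (cmpA h g f)) \oc (c (h \oc g) f \oc (c h g \om idm (D_ f))).

(* The pasting (s, s'') : g f -> g' f' of (s, s') : f -> f' and
   (s', s'') : g -> g'. *)
Lemma square_paste_subproof (X Y Z X' Y' Z' : F) (g : hom Y Z) (f : hom X Y)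
    (g' : hom Y' Z') (f' : hom X' Y')
    (s : iso X X') (s' : iso Y Y') (s'' : iso Z Z')
    (ef : s' \oc f = f' \oc s) (eg : s'' \oc g = g' \oc s') :
  s'' \oc (g \oc f) = (g' \oc f') \oc s.
Proof. by rewrite cmpA eg -cmpA ef cmpA. Qed.

Definition comp_natural := forall (X Y Z X' Y' Z' : F)
    (g : hom Y Z) (f : hom X Y) (g' : hom Y' Z') (f' : hom X' Y')
    (s : iso X X') (s' : iso Y Y') (s'' : iso Z Z')
    (ef : s' \oc f = f' \oc s) (eg : s'' \oc g = g' \oc s'),
  fmapD (square_paste_subproof ef eg) \oc c g f
  = c g' f' \oc (fmapD eg \om fmapD ef).

Definition tenD (X Y X' Y' : F) (f : hom X Y) (f' : hom X' Y') :
    hom (D_ f \ox D_ f') (D_ (f \om f')) :=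
  ften D (Arrow f) (Arrow f').

Definition comp_monoidal := forall (X Y Z X' Y' Z' : F)
    (g : hom Y Z) (f : hom X Y) (g' : hom Y' Z') (f' : hom X' Y'),
  tenD (g \oc f) (g' \oc f') \oc (c g f \om c g' f')
  = castD (esym (tensmM g f g' f'))
      \oc (c (g \om g') (f \om f') \oc (tenD g g' \om tenD f f'))
      \oc middle_four (D_ g) (D_ f) (D_ g') (D_ f').

Definition comp_monoidal_one :=
  castD (cmp1m (idm one)) \oc c (idm one) (idm one) \oc (fone D \om fone D)
  = fone D \oc lunit one.

Lemma square_idm_subproof (X Y : F) (s : iso X Y) :
  s \oc idm X = idm Y \oc s.
Proof. by rewrite cmp1m cmpm1. Qed.

Definition unit_natural := forall (X Y : F) (s : iso X Y),
  fmapD (square_idm_subproof s) \oc u X = u Y.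

Definition unit_monoidal := forall X Y : F,
  castD (tensm1 X Y) \oc tenD (idm X) (idm Y) \oc (u X \om u Y)
  = u (X \ox Y) \oc lunit one.

Definition unit_monoidal_one := u one = fone D.

Definition unit_left := forall (X Y : F) (f : hom X Y),
  castD (cmp1m f) \oc c (idm Y) f \oc (u Y \om idm (D_ f)) = lunit (D_ f).

Definition unit_right := forall (X Y : F) (f : hom X Y),
  castD (cmpm1 f) \oc c f (idm X) \oc (idm (D_ f) \om u X) = runit (D_ f).

End Laws.

(* "Strictly monoidal up to equivalence" is strong monoidal: the comparison maps
   ften and fone are isomorphisms. *)
Record weak_enrichment := WeakEnrichment {
  we_fun :> strong_functor (iso_arrow_smc F) E;
  we_comp : comp_data we_fun;
  we_unit : unit_data we_fun;
  we_compA : comp_associative we_comp;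
  we_comp_nat : comp_natural we_comp;
  we_comp_ten : comp_monoidal we_comp;
  we_comp_one : comp_monoidal_one we_comp;
  we_unit_nat : unit_natural we_unit;
  we_unit_ten : unit_monoidal we_unit;
  we_unit_one : unit_monoidal_one we_unit;
  we_unitl : unit_left we_comp we_unit;
  we_unitr : unit_right we_comp we_unit
}.

(* A monoidal natural isomorphism compatible with compositions and units. *)
Definition we_equiv (D D' : weak_enrichment) : Prop :=
  exists theta : forall phi : iso_arrow_smc F, iso (D phi) (D' phi),
  [/\ forall (phi psi : iso_arrow_smc F) (s : hom phi psi),
        theta psi \oc fmap D s = fmap D' s \oc theta phi,
      forall phi psi : iso_arrow_smc F,
        theta (phi \ox psi) \oc ften D phi psi
        = ften D' phi psi \oc (theta phi \om theta psi),
      theta one \oc fone D = fone D',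
      forall (X Y Z : F) (g : hom Y Z) (f : hom X Y),
        theta (Arrow (g \oc f)) \oc we_comp D g f
        = we_comp D' g f \oc (theta (Arrow g) \om theta (Arrow f))
    & forall X : F, theta (Arrow (idm X)) \oc we_unit D X = we_unit D' X].

End WeakEnrichment.
Arguments weak_enrichment : clear implicits.

(** * Monoids and (left) modules *)

Section AlgMod.
Context {E : sym_mon_cat}.

Record alg_data := AlgData {
  alg_ob :> E;
  alg_mul : hom (alg_ob \ox alg_ob) alg_ob;
  alg_one : hom one alg_ob
}.

Definition is_monoid (A : alg_data) : Prop :=
  [/\ alg_mul A \oc (alg_mul A \om idm A)
        = alg_mul A \oc (idm A \om alg_mul A) \oc assoc A A A,
      alg_mul A \oc (alg_one A \om idm A) = lunit A
    & alg_mul A \oc (idm A \om alg_one A) = runit A].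

Record mod_data (A : alg_data) := ModData {
  mod_ob :> E;
  mod_act : hom (A \ox mod_ob) mod_ob
}.

Definition is_module (A : alg_data) (M : mod_data A) : Prop :=
  mod_act M \oc (alg_mul A \om idm M)
    = mod_act M \oc (idm A \om mod_act M) \oc assoc A A M
  /\ mod_act M \oc (alg_one A \om idm M) = lunit M.

Record pair_data := PairData { pair_alg : alg_data; pair_mod : mod_data pair_alg }.

Record alg_mod := AlgMod {
  am_data :> pair_data;
  am_monoid : is_monoid (pair_alg am_data);
  am_module : is_module (pair_mod am_data)
}.

Definition alg_mod_iso (P Q : alg_mod) : Prop :=
  exists (a : iso (pair_alg P : E) (pair_alg Q))
         (m : iso (pair_mod P : E) (pair_mod Q)),
  [/\ a \oc alg_mul (pair_alg P) = alg_mul (pair_alg Q) \oc (a \om a),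
      a \oc alg_one (pair_alg P) = alg_one (pair_alg Q)
    & m \oc mod_act (pair_mod P) = mod_act (pair_mod Q) \oc (a \om m)].

End AlgMod.
Arguments alg_data : clear implicits.
Arguments pair_data : clear implicits.
Arguments alg_mod : clear implicits.

(** * Finite sets and injections *)

Definition FI_hom (X Y : finType) := {f : {ffun X -> Y} | injectiveb f}.

Definition FI_fun (X Y : finType) (f : FI_hom X Y) : X -> Y := val f.

Lemma FI_eq (X Y : finType) (f g : FI_hom X Y) : FI_fun f =1 FI_fun g -> f = g.
Proof. by move=> e; apply/val_inj/ffunP. Qed.

Lemma inj_of_subproof (X Y : finType) (f : X -> Y) :
  injective f -> injectiveb (finfun f).
Proof. by move=> fI; apply/injectiveP => x y; rewrite !ffunE => /fI. Qed.

Definition inj_of (X Y : finType) (f : X -> Y) (fI : injective f) : FI_hom X Y :=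
  exist (fun f : {ffun X -> Y} => is_true (injectiveb f))
    (finfun f) (inj_of_subproof fI).

Lemma inj_ofE (X Y : finType) (f : X -> Y) (fI : injective f) :
  FI_fun (inj_of fI) =1 f.
Proof. by move=> x; rewrite /FI_fun ffunE. Qed.

Lemma FI_inj (X Y : finType) (f : FI_hom X Y) : injective (FI_fun f).
Proof. exact/injectiveP/(valP f). Qed.

Definition FI_id (X : finType) : FI_hom X X := inj_of (@inj_id X).

Definition FI_cmp (X Y Z : finType) (g : FI_hom Y Z) (f : FI_hom X Y) : FI_hom X Z :=
  inj_of (inj_comp (@FI_inj _ _ g) (@FI_inj _ _ f)).

Lemma FI_idE (X : finType) : FI_fun (FI_id X) =1 id.
Proof. exact: inj_ofE. Qed.

Lemma FI_cmpE (X Y Z : finType) (g : FI_hom Y Z) (f : FI_hom X Y) :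
  FI_fun (FI_cmp g f) =1 FI_fun g \o FI_fun f.
Proof. exact: inj_ofE. Qed.

Definition FI : category.
Proof.
apply: (@Category finType FI_hom FI_id FI_cmp);
  abstract by move=> *; apply: FI_eq => ?;
    rewrite !FI_cmpE /= ?FI_cmpE ?FI_idE.
Defined.

Definition sum_map (X X' Y Y' : Type) (f : X -> X') (g : Y -> Y')
    (z : X + Y) : X' + Y' :=
  match z with inl x => inl (f x) | inr y => inr (g y) end.

Lemma sum_map_inj (X X' Y Y' : Type) (f : X -> X') (g : Y -> Y') :
  injective f -> injective g -> injective (sum_map f g).
Proof. by move=> fI gI [x|x] [y|y] //= [] => [/fI|/gI] ->. Qed.

Definition FI_sum (X X' Y Y' : finType) (f : FI_hom X X') (g : FI_hom Y Y') :
    FI_hom (X + Y)%type (X' + Y')%type :=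
  inj_of (sum_map_inj (@FI_inj _ _ f) (@FI_inj _ _ g)).

Lemma FI_sumE (X X' Y Y' : finType) (f : FI_hom X X') (g : FI_hom Y Y') :
  FI_fun (FI_sum f g) =1 sum_map (FI_fun f) (FI_fun g).
Proof. exact: inj_ofE. Qed.

Definition sumA (X Y Z : Type) (w : (X + Y) + Z) : X + (Y + Z) :=
  match w with
  | inl (inl x) => inl x | inl (inr y) => inr (inl y) | inr z => inr (inr z)
  end.
Definition sumAV (X Y Z : Type) (w : X + (Y + Z)) : (X + Y) + Z :=
  match w with
  | inl x => inl (inl x) | inr (inl y) => inl (inr y) | inr (inr z) => inr z
  end.
Definition sumC (X Y : Type) (w : X + Y) : Y + X :=
  match w with inl x => inr x | inr y => inl y end.
Definition sum0l (X : Type) (w : void + X) : X :=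
  match w with inl v => of_void X v | inr x => x end.
Definition sum0r (X : Type) (w : X + void) : X :=
  match w with inl x => x | inr v => of_void X v end.

Lemma sumAK X Y Z : cancel (@sumA X Y Z) (@sumAV X Y Z).
Proof. by case=> [[]|]. Qed.
Lemma sumAVK X Y Z : cancel (@sumAV X Y Z) (@sumA X Y Z).
Proof. by case=> [|[]]. Qed.
Lemma sumCK X Y : cancel (@sumC X Y) (@sumC Y X).
Proof. by case. Qed.
Lemma sum0lK X : cancel (@sum0l X) inr.
Proof. by case=> [[]|]. Qed.
Lemma sum0lVK X : cancel inr (@sum0l X).
Proof. by []. Qed.
Lemma sum0rK X : cancel (@sum0r X) inl.
Proof. by case=> [|[]]. Qed.
Lemma sum0rVK X : cancel inl (@sum0r X).
Proof. by []. Qed.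

Definition FI_iso (X Y : finType) (f : X -> Y) (g : Y -> X)
    (fK : cancel f g) (gK : cancel g f) : @iso FI X Y.
Proof.
apply: (@Iso FI X Y (inj_of (can_inj fK)) (inj_of (can_inj gK)));
  abstract by apply: FI_eq => x; rewrite FI_cmpE FI_idE /= !inj_ofE.
Defined.

Definition FI_tens (X Y : FI) : FI := (X + Y)%type : finType.

Definition FI_smc : sym_mon_cat.
Proof.
apply: (@SymMonCat FI FI_tens FI_sum (void : finType)
  (fun X Y Z => FI_iso (@sumAK X Y Z) (@sumAVK X Y Z))
  (fun X => FI_iso (@sum0lK X) (@sum0lVK X))
  (fun X => FI_iso (@sum0rK X) (@sum0rVK X))
  (fun X Y => FI_iso (@sumCK X Y) (@sumCK Y X)));
  abstract by move=> *; apply: FI_eq => w;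
    do ?[by [] | progress rewrite /= ?(FI_cmpE, FI_sumE, FI_idE, inj_ofE)
        | case: w => w].
Defined.

(** * The correspondence *)

(* The one-point set, image of the unique object of the trivial groupoid, and the injection from the empty set to it. *)
Definition pt : FI_smc := (unit : finType).

Lemma of_void_inj (X : Type) : injective (of_void X).
Proof. by case. Qed.

Definition from_empty : @hom FI_smc one pt := inj_of (@of_void_inj unit).

(* The algebra D(id_pt) and the module D(empty -> pt), with multiplication and
   action given by the compositions over id_pt \oc id_pt = id_pt and
   id_pt \oc from_empty = from_empty. *)
Definition pair_of (E : sym_mon_cat) (D : weak_enrichment FI_smc E) :
    pair_data E :=
  let c := we_comp D in
  let A : alg_data E :=
    @AlgData E (D (Arrow (idm pt)))
      (castD D (cmp1m (idm pt)) \oc c _ _ _ (idm pt) (idm pt))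
      (we_unit D pt) in
  @PairData E A
    (@ModData E A (D (Arrow from_empty))
       (castD D (cmp1m from_empty) \oc c _ _ _ (idm pt) from_empty)).

(* Main.v *)
Require Import Defs.
From HB Require Import structures.
From mathcomp Require Import all_boot.
From Stdlib Require Import ProofIrrelevance IndefiniteDescription Program.Equality.
(* Imported again so that [one] is the unit object. *)
Import Defs.

(** Every injection X -> Y is, fibre by fibre, a disjoint union of copies of the
identity of the point and of the inclusion of the empty set in the point. So a
strong monoidal functor D on the groupoid of injections is determined by the two
objects A = D(id_pt) and M = D(empty -> pt), and D(phi) is a tensor product of
copies of A over the image of phi and of copies of M over its complement. A
composable pair (g, f) also splits over the points of its codomain. Over one
point it is (id, id), (id, empty -> pt) or (empty -> pt, id_empty), so a
composition is made of a map A A -> A, a map A M -> M and a map M 1 -> M; the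
last one is forced by the unit laws, and the first two are a multiplication and an
action. Their axioms are the associativity and unit laws of D at the point
(pair_of_monoid, pair_of_module).

It remains to see that isomorphisms of pairs extend to enrichments and that every
pair comes from an enrichment.

For the first, an isomorphism of pairs gives isomorphisms D -> D' on iterated
disjoint unions of the two generating injections (theta_exists). These are natural
because each isomorphism between two such unions is composed of associators,
unitors and braidings (natural_all). They therefore extend to all injections, and
compatibility with compositions and units is checked on the three kinds of fibres
by an induction principle for composable pairs (composable_pair_ind,
pair_iso_equiv).

For the second, D(phi) has to be built as an unordered tensor product, on which the
bijections of Y act. The coherence needed is obtained in two steps. A reordering of
a tensor product of a list is a composite of extractions of one factor to the
front, which are iterated swaps, and for a list without repetitions it depends only
on its source and target (reorder_unique). Next, an element of an object X is a
morphism to X from a tensor product of copies of A and M indexed by a list of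
labels, and a morphism f maps x to y when f x is y up to a reordering. Then
associators, unitors and braidings map elements as they do in sets, and the
multiplication maps words to their concatenation, so A and M look like the free
monoid and the free module on the labels. A morphism out of a tensor product of
copies of A and M is determined by its effect on these elements, because an element
with distinct labels is a split epimorphism (maps_unique). All the axioms of the
free enrichment are thus equalities between functions on finite sets with values in
words, where associativity is that of concatenation. *)

Set Implicit Arguments.
Unset Strict Implicit.
Unset Printing Implicit Defensive.
Local Open Scope cat_scope.

(** * Calculus in symmetric monoidal categories *)

Section Category.
Context {C : category}.

(** Composites are kept nested to the right; these two lemmas rewrite with an
equation in the middle of such a composite. *)
Lemma reassoc (y z t : C) (a : hom z t) (b : hom y z) (c : hom y t) :
  a \oc b = c -> forall x (r : hom x y), a \oc (b \oc r) = c \oc r.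
Proof. by move=> <- x r; rewrite cmpA. Qed.

Lemma reassoc3 (y z t v : C) (a : hom t v) (b : hom z t) (c : hom y z)
    (d : hom y v) :
  a \oc (b \oc c) = d -> forall x (r : hom x y), a \oc (b \oc (c \oc r)) = d \oc r.
Proof. by move=> <- x r; rewrite !cmpA. Qed.

Lemma isoKr (x y z : C) (f : iso x y) (r : hom z x) : bwd f \oc (f \oc r) = r.
Proof. by rewrite cmpA isoK cmp1m. Qed.

Lemma isoVKr (x y z : C) (f : iso x y) (r : hom z y) : f \oc (bwd f \oc r) = r.
Proof. by rewrite cmpA isoVK cmp1m. Qed.

Lemma iso_monic (x y z : C) (f : iso x y) (g h : hom z x) :
  f \oc g = f \oc h -> g = h.
Proof. by move=> e; rewrite -(isoKr f g) e isoKr. Qed.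

Lemma iso_epic (x y z : C) (f : iso x y) (g h : hom y z) :
  g \oc f = h \oc f -> g = h.
Proof. by move=> e; rewrite -[g]cmpm1 -(isoVK f) cmpA e -cmpA isoVK cmpm1. Qed.

End Category.

Section Monoidal.
Context {C : sym_mon_cat}.
Implicit Types x y z t : C.

Lemma tens_idr x y y' y'' (g : hom y' y'') (f : hom y y') :
  idm x \om (g \oc f) = (idm x \om g) \oc (idm x \om f).
Proof. by rewrite -tensmM cmp1m. Qed.

Lemma tens_idl x y y' y'' (g : hom y' y'') (f : hom y y') :
  (g \oc f) \om idm x = (g \om idm x) \oc (f \om idm x).
Proof. by rewrite -tensmM cmp1m. Qed.

Lemma tens_lr x x' y y' (f : hom x x') (g : hom y y') :
  f \om g = (f \om idm y') \oc (idm x \om g).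
Proof. by rewrite -tensmM cmp1m cmpm1. Qed.

Lemma tens_rl x x' y y' (f : hom x x') (g : hom y y') :
  f \om g = (idm x' \om g) \oc (f \om idm y).
Proof. by rewrite -tensmM cmp1m cmpm1. Qed.

Lemma tens_cmpr x x' y y' y'' (f : hom x x') (g : hom y' y'') (h : hom y y') :
  f \om (g \oc h) = (idm x' \om g) \oc (f \om h).
Proof. by rewrite -tensmM cmp1m. Qed.

Lemma tens_cmpl x x' y y' y'' (f : hom x x') (g : hom y' y'') (h : hom y y') :
  (g \oc h) \om f = (g \om idm x') \oc (h \om f).
Proof. by rewrite -tensmM cmp1m. Qed.

Lemma one_tens_inj x y (f g : hom x y) : idm one \om f = idm one \om g -> f = g.
Proof.
by move=> e; apply: (iso_epic (f := lunit x)); rewrite -!lunit_nat e.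
Qed.

Lemma tens_one_inj x y (f g : hom x y) : f \om idm one = g \om idm one -> f = g.
Proof.
by move=> e; apply: (iso_epic (f := runit x)); rewrite -!runit_nat e.
Qed.

(** Kelly's argument: this and the next unit laws follow from the triangle and the
pentagon after tensoring with the unit, which is faithful. *)
Lemma lunit_tens x y : lunit (x \ox y) \oc assoc one x y = lunit x \om idm y.
Proof.
apply: one_tens_inj.
apply: (iso_epic (f := assoc _ _ _)).
apply: (iso_epic (f := iso_tens (assoc one one x) (iso_id y))) => /=.
rewrite tens_idr -!cmpA pentagon.
rewrite (reassoc (triangle _ _)).
rewrite -[idm (x \ox y)]tensm1 -assoc_nat.
rewrite -triangle tens_idl cmpA assoc_nat.
by rewrite -!cmpA.
Qed.

Lemma runit_tens x y : (idm x \om runit y) \oc assoc x y one = runit (x \ox y).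
Proof.
apply: tens_one_inj.
apply: (iso_monic (f := assoc _ _ _)).
rewrite tens_idl (reassoc (assoc_nat _ _ _)) -triangle tens_idr -!cmpA.
rewrite pentagon -triangle.
by rewrite -[idm (x \ox y)]tensm1 (reassoc (assoc_nat _ _ _)) -!cmpA.
Qed.

Lemma lunit_one_tens x : lunit (one \ox x) = idm one \om lunit x :> hom _ _.
Proof. by apply: (iso_monic (f := lunit x)); rewrite -lunit_nat. Qed.

Lemma lunit_one : lunit (one : C) = runit one :> hom _ _.
Proof.
by apply: tens_one_inj; rewrite -lunit_tens lunit_one_tens triangle.
Qed.

(** The hexagon for x, 1 and z, with the unit cancelled. *)
Lemma lunit_braid x : lunit x \oc braid x one = runit x.
Proof.
apply: tens_one_inj; apply: (iso_monic (f := braid _ _)).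
rewrite tens_idl -(lunit_tens x) -!cmpA.
rewrite (reassoc (esym (lunit_nat _))) -!cmpA -hexagon.
rewrite (reassoc (lunit_tens _ _)) (reassoc (esym (braid_nat _ _))) -!cmpA.
by rewrite triangle.
Qed.

Lemma runit_braid x : runit x \oc braid one x = lunit x.
Proof. by rewrite -lunit_braid -cmpA braidK cmpm1. Qed.
End Monoidal.

(** The exchange of the two first factors of x (y z); the braiding and all
reorderings below are made of it. *)
HB.lock Definition swap (C : sym_mon_cat) (x y z : C) :
    hom (x \ox (y \ox z)) (y \ox (x \ox z)) :=
  assoc y x z \oc ((braid x y \om idm z) \oc bwd (assoc x y z)).

Section Swap.
Context {C : sym_mon_cat}.
Implicit Types x y z t : C.

Lemma bwd_assoc_nat x x' y y' z z' (f : hom x x') (g : hom y y') (h : hom z z') :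
  bwd (assoc x' y' z') \oc (f \om (g \om h))
  = ((f \om g) \om h) \oc bwd (assoc x y z).
Proof.
apply: (iso_monic (f := assoc _ _ _)); rewrite isoVKr (reassoc (assoc_nat _ _ _)).
by rewrite -cmpA isoVK cmpm1.
Qed.

Lemma swap_nat x x' y y' z z' (f : hom x x') (g : hom y y') (h : hom z z') :
  swap x' y' z' \oc (f \om (g \om h)) = (g \om (f \om h)) \oc swap x y z.
Proof.
rewrite swap.unlock -!cmpA bwd_assoc_nat (reassoc (esym (tensmM _ _ _ _))).
rewrite braid_nat cmp1m -[h in LHS]cmpm1 tensmM -!cmpA.
by rewrite (reassoc (assoc_nat _ _ _)) -!cmpA.
Qed.

Lemma swapK x y z : swap y x z \oc swap x y z = idm _.
Proof.
rewrite swap.unlock -!cmpA isoKr (reassoc (esym (tensmM _ _ _ _))) braidK cmp1m.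
by rewrite tensm1 cmp1m isoVK.
Qed.

Lemma swap_assoc x y z :
  swap x y z \oc assoc x y z = assoc y x z \oc (braid x y \om idm z).
Proof. by rewrite swap.unlock -!cmpA isoK cmpm1. Qed.

(** The pentagon: a swap does not see a factor tensored on the right. *)
Lemma swap_tens x y z t :
  swap x y (z \ox t) \oc ((idm x \om assoc y z t) \oc assoc x (y \ox z) t)
  = (idm y \om assoc x z t) \oc (assoc y (x \ox z) t \oc (swap x y z \om idm t)).
Proof.
rewrite swap.unlock.
apply: (iso_epic (f := iso_tens (assoc x y z) (iso_id t))) => /=.
rewrite -!cmpA pentagon isoKr -[idm (z \ox t)]tensm1 -assoc_nat.
rewrite !tens_idl -!cmpA -tensmM isoK cmp1m tensm1 cmpm1.
by rewrite !cmpA; congr (_ \oc _); rewrite -!cmpA pentagon.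
Qed.

(** The hexagon, for a third factor tensored on the right. *)
Lemma swap_hexagon x y z t :
  (idm y \om swap x z t) \oc (swap x y (z \ox t) \oc (idm x \om assoc y z t))
  = assoc y z (x \ox t) \oc swap x (y \ox z) t.
Proof.
apply: (iso_epic (f := assoc _ _ _)).
rewrite -!cmpA swap_tens swap.unlock !tens_idr -!cmpA.
rewrite isoK cmpm1.
apply: (iso_epic (f := iso_tens (assoc x y z) (iso_id t))) => /=.
rewrite -!cmpA -!tensmM !cmp1m -!cmpA isoK cmpm1.
have -> : (idm y \om bwd (assoc x z t))
   \oc ((idm y \om assoc x z t) \oc (assoc y (x \ox z) t \oc
     ((assoc y x z \oc (braid x y \om idm z)) \om idm t)))
  = assoc y (x \ox z) t \oc
     ((assoc y x z \oc (braid x y \om idm z)) \om idm t).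
  by rewrite (reassoc (esym (tens_idr _ _ _))) isoK tensm1 cmp1m.
rewrite (reassoc (esym (assoc_nat _ _ _))) -!cmpA -tensmM cmp1m.
rewrite -hexagon !tens_idl.
by rewrite (reassoc3 (pentagon _ _ _ _)) -!cmpA.
Qed.

(** Naturality of the swap of x with y z, for the braiding of y and z. *)
Lemma yang_baxter x y z t :
  swap y z (x \ox t) \oc ((idm y \om swap x z t) \oc swap x y (z \ox t))
  = (idm z \om swap x y t) \oc (swap x z (y \ox t) \oc (idm x \om swap y z t)).
Proof.
apply: (iso_epic (f := iso_tens (iso_id x) (assoc y z t))) => /=.
rewrite -!cmpA swap_hexagon.
rewrite (reassoc (swap_assoc _ _ _)) -[idm (x \ox t)]tensm1 -!cmpA -swap_nat.
rewrite -[in RHS]tens_idr swap_assoc tens_idr.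
by rewrite (reassoc3 (swap_hexagon _ _ _ _)) -!cmpA.
Qed.

Lemma swap_hexagon' x y z t :
  swap x z (y \ox t) \oc ((idm x \om swap y z t) \oc assoc x y (z \ox t))
  = (idm z \om assoc x y t) \oc swap (x \ox y) z t.
Proof.
rewrite -[LHS]cmpm1 -(swapK (x \ox y) z t) -!cmpA.
rewrite (reassoc (esym (swap_hexagon _ _ _ _))) -!cmpA.
rewrite (reassoc (esym (tens_idr _ _ _))) swapK tensm1 cmp1m.
by rewrite (reassoc (swapK _ _ _)) cmp1m.
Qed.

Lemma lunit_swap y z : (idm y \om lunit z) \oc swap one y z = lunit (y \ox z).
Proof.
rewrite swap.unlock (reassoc (triangle _ _)) (reassoc (esym (tens_idl _ _ _))).
by rewrite runit_braid -lunit_tens -cmpA isoVK cmpm1.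
Qed.

(** [middle_four] as an isomorphism, in order to cancel it. *)
Definition middle_four_iso x y z t :
    iso ((x \ox y) \ox (z \ox t)) ((x \ox z) \ox (y \ox t)) :=
  iso_cmp (iso_cmp (iso_inv (assoc x z (y \ox t)))
    (iso_tens (iso_id x) (iso_cmp (iso_cmp (assoc z y t)
       (iso_tens (braid y z) (iso_id t))) (iso_inv (assoc y z t)))))
    (assoc x y (z \ox t)).

Lemma middle_fourE x y z t :
  middle_four x y z t
  = bwd (assoc _ _ _) \oc ((idm x \om swap y z t) \oc assoc _ _ _).
Proof. by rewrite /middle_four swap.unlock !cmpA. Qed.

Lemma middle_four_nat x x' y y' z z' t t' (f : hom x x') (g : hom y y')
    (h : hom z z') (k : hom t t') :
  middle_four x' y' z' t' \oc ((f \om g) \om (h \om k))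
  = ((f \om h) \om (g \om k)) \oc middle_four x y z t.
Proof.
rewrite !middle_fourE -!cmpA assoc_nat (reassoc (esym (tensmM _ _ _ _))) swap_nat.
by rewrite cmp1m -[f in LHS]cmpm1 tensmM -!cmpA (reassoc (bwd_assoc_nat _ _ _)) -!cmpA.
Qed.
End Swap.

(** * Reordering tensor products of lists *)

Inductive word (K : Type) := Wone | Wgen of K | Wten of word K & word K.
Arguments Wone {K}.

Fixpoint den (C : sym_mon_cat) (K : Type) (G : K -> C) (w : word K) : C :=
  match w with
  | Wone => one
  | Wgen c => G c
  | Wten w w' => den G w \ox den G w'
  end.

Definition wlist (K I : Type) (b : I -> K) (s : seq I) : word K :=
  foldr (fun i w => Wten (Wgen (b i)) w) Wone s.

(** [ins i s t] says that t is s with i inserted, and remembers where. Being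
derivations rather than equations between lists, [ins] and [permute] index maps in
a category without any transport along equalities of objects. *)
Inductive ins (I : Type) (i : I) : seq I -> seq I -> Type :=
  | ins_head s : ins i s (i :: s)
  | ins_tail j s t : ins i s t -> ins i (j :: s) (j :: t).

Inductive permute (I : Type) : seq I -> seq I -> Type :=
  | permute_nil : permute [::] [::]
  | permute_cons i s s' t : ins i s' s -> permute s' t -> permute s (i :: t).
Arguments ins_head {I i s}.
Arguments permute_nil {I}.

Section Combinatorics.
Context {I : Type}.
Implicit Types (i j : I) (s t : seq I).

Fixpoint permute_id s : permute s s :=
  match s with
  | [::] => permute_nil
  | i :: s => permute_cons ins_head (permute_id s)
  end.

Fixpoint ins_catr i s s' t (e : ins i s s') : ins i (s ++ t) (s' ++ t) :=
  match e with
  | ins_head s => ins_head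
  | ins_tail j s s' e => ins_tail j (ins_catr t e)
  end.

Fixpoint ins_mid i s t : ins i (s ++ t) (s ++ i :: t) :=
  match s with
  | [::] => ins_head
  | j :: s => ins_tail j (ins_mid i s t)
  end.

Fixpoint permute_catr s s' t (p : permute s s') : permute (s ++ t) (s' ++ t) :=
  match p with
  | permute_nil => permute_id t
  | permute_cons i s s1 s' e p => permute_cons (ins_catr t e) (permute_catr t p)
  end.

Fixpoint permute_catl s t t' (p : permute t t') : permute (s ++ t) (s ++ t') :=
  match s with
  | [::] => p
  | i :: s => permute_cons ins_head (permute_catl s p)
  end.

Fixpoint permute_cats0 s : permute (s ++ [::]) s :=
  match s with
  | [::] => permute_nil
  | i :: s => permute_cons ins_head (permute_cats0 s)
  end.

Fixpoint permute_swap s t : permute (s ++ t) (t ++ s) :=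
  match t with
  | [::] => permute_cats0 s
  | j :: t => permute_cons (ins_mid j s t) (permute_swap s t)
  end.

Fixpoint permute_catA s t u : permute ((s ++ t) ++ u) (s ++ (t ++ u)) :=
  match s with
  | [::] => permute_id (t ++ u)
  | i :: s => permute_cons ins_head (permute_catA s t u)
  end.

(** Inserting at the head: the inverse of an extraction. *)
Fixpoint permute_ins i s t (e : ins i s t) : permute (i :: s) t :=
  match e with
  | ins_head s => permute_id (i :: s)
  | ins_tail j s t e => permute_cons (ins_tail i ins_head) (permute_ins e)
  end.
End Combinatorics.

Section EqCombinatorics.
Context {I : eqType}.
Implicit Types (i j : I) (s t : seq I).

Lemma ins_perm i s t (e : ins i s t) : perm_eq (i :: s) t.
Proof.
elim: e => [s'|j s' t' _ IH] //.
by rewrite (perm_catCA [:: i] [:: j] s') perm_cons.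
Qed.

(** Without repetitions there is only one place to extract i from. *)
Lemma ins_unique i s s' t (e : ins i s t) (e' : ins i s' t) : uniq t ->
  existT (fun u => ins i u t) s e = existT _ s' e'.
Proof.
elim: e s' e' => [t1|j s1 t1 e IH] s' e' /= /andP[it1 ut1].
  dependent destruction e' => //.
  by move: it1; rewrite -(perm_mem (ins_perm e')) inE eqxx.
dependent destruction e'.
  by move: it1; rewrite -(perm_mem (ins_perm e)) inE eqxx.
have /= := IH _ e' ut1 => ee.
by dependent destruction ee.
Qed.

Lemma ins_exists i t : i \in t -> exists s, inhabited (ins i s t).
Proof.
elim: t => [|j t IH] //; rewrite inE => /predU1P[->|/IH[s [e]]].
  by exists t; split; apply: ins_head.
by exists (j :: s); split; apply: ins_tail.
Qed.

Lemma permute_exists s t : perm_eq s t -> inhabited (permute s t).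
Proof.
elim: t s => [|i t IH] s; first by move/perm_nilP => ->; split; apply: permute_nil.
move=> st; have /ins_exists[s' [e]] : i \in s by rewrite (perm_mem st) inE eqxx.
have [|p] := IH s'; first by rewrite -(perm_cons i) (perm_trans (ins_perm e)).
by split; apply: permute_cons e p.
Qed.
End EqCombinatorics.

Section Reordering.
Context {C : sym_mon_cat} {K : Type} (G : K -> C) {I : Type} (b : I -> K).
Implicit Types (i j : I) (s t u : seq I).

Local Notation T s := (den G (wlist b s)).

Fixpoint pull i s t (e : ins i s t) : hom (T t) (G (b i) \ox T s) :=
  match e with
  | ins_head s => idm _
  | ins_tail j s t e => swap _ _ _ \oc (idm (G (b j)) \om pull e)
  end.

Fixpoint reorder s t (p : permute s t) : hom (T s) (T t) :=
  match p with
  | permute_nil => idm _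
  | permute_cons i s s' t e p => (idm (G (b i)) \om reorder p) \oc pull e
  end.

Lemma reorder_id s : reorder (permute_id s) = idm (T s).
Proof. by elim: s => [|i s IH] //=; rewrite IH tensm1 cmpm1. Qed.

(** The Yang-Baxter equation is needed when both factors lie in the tail. *)
Lemma pull_pull i j s s1 s2 (e : ins j s1 s) (e' : ins i s2 s1) :
  exists s' (f : ins i s' s) (f' : ins j s2 s'),
    swap _ _ _ \oc ((idm (G (b j)) \om pull e') \oc pull e)
    = (idm (G (b i)) \om pull f') \oc pull f.
Proof.
elim: e s2 e' => [s3|k s3 t3 e IH] s2 e'.
  exists (j :: s2), (ins_tail j e'), ins_head => /=.
  by rewrite cmpm1 tensm1 cmp1m.
dependent destruction e'.
  exists t3, ins_head, e => /=.
  by rewrite tensm1 cmp1m cmpm1 (reassoc (swapK _ _ _)) cmp1m.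
have [s' [f [f' E]]] := IH _ e'.
exists (k :: s'), (ins_tail k f), (ins_tail k f') => /=.
rewrite !tens_idr -!cmpA.
rewrite [in LHS](reassoc (esym (swap_nat _ _ _))) -!cmpA.
rewrite (reassoc3 (yang_baxter _ _ _ _)) -!cmpA.
rewrite -!tens_idr E !tens_idr.
by rewrite [in RHS](reassoc (esym (swap_nat _ _ _))) -!cmpA.
Qed.

(** The step by which composites of reorderings are reorderings. *)
Lemma pull_reorder i s t t' (p : permute s t) (e : ins i t' t) :
  exists s' (e' : ins i s' s) (p' : permute s' t'),
    pull e \oc reorder p = (idm (G (b i)) \om reorder p') \oc pull e'.
Proof.
elim: p t' e => [|j s0 s1 t1 ej p IH] t' e; first by inversion e.
dependent destruction e.
  by exists s1, ej, p; rewrite /= cmp1m.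
have [s3 [e1 [p1 E]]] := IH _ e.
have [s' [e' [ej' E']]] := pull_pull ej e1.
exists s', e', (permute_cons ej' p1) => /=.
rewrite -!cmpA (reassoc (esym (tens_idr _ _ _))) E tens_idr -!cmpA.
rewrite (reassoc (swap_nat _ _ _)) -!cmpA E'.
by rewrite tens_idr -!cmpA.
Qed.

Lemma reorder_cmp s t u (p : permute s t) (q : permute t u) :
  exists r : permute s u, reorder q \oc reorder p = reorder r.
Proof.
elim: q s p => [|i t0 t1 u1 e q IH] s p; first by exists p; rewrite /= cmp1m.
have [s' [e' [p' E]]] := pull_reorder p e.
have [r Er] := IH _ p'.
by exists (permute_cons e' r); rewrite /= -cmpA E cmpA -tens_idr Er.
Qed.
End Reordering.

(** Coherence: by [ins_unique], both reorderings extract the same factors. *)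
Lemma reorder_unique (C : sym_mon_cat) (K : Type) (G : K -> C) (I : eqType)
    (b : I -> K) (s t : seq I) (p q : permute s t) :
  uniq s -> reorder G b p = reorder G b q.
Proof.
elim: p q => [|i s0 s1 t1 e p IH] q us; first by dependent destruction q.
dependent destruction q => /=.
have E := ins_unique e i1 us; dependent destruction E.
rewrite (IH q) //.
by have := us; rewrite -(perm_uniq (ins_perm i1)) => /andP[].
Qed.

Section Concatenation.
Context {C : sym_mon_cat} {K : Type} (G : K -> C) {I : Type} (b : I -> K).
Implicit Types (i j : I) (s t u : seq I).

Local Notation T s := (den G (wlist b s)).

Fixpoint tcat s t : iso (T s \ox T t) (T (s ++ t)) :=
  match s with
  | [::] => lunit (T t)
  | i :: s => iso_cmp (iso_tens (iso_id (G (b i))) (tcat s t)) (assoc _ _ _)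
  end.

Lemma pull_catr i s s' t (e : ins i s s') :
  pull G b (ins_catr t e) \oc tcat s' t
  = (idm _ \om tcat s t) \oc (assoc _ _ _ \oc (pull G b e \om idm (T t))).
Proof.
elim: e => [s1|j s1 t1 e IH] /=; first by rewrite cmp1m tensm1 cmpm1.
rewrite -!cmpA (reassoc (esym (tens_idr _ _ _))) IH !tens_idr tens_idl -!cmpA.
rewrite -assoc_nat (reassoc (swap_nat _ _ _)) -!cmpA.
by rewrite (reassoc3 (swap_tens _ _ _ _)) -!cmpA.
Qed.

Lemma reorder_catr s s' t (p : permute s s') :
  reorder G b (permute_catr t p) \oc tcat s t
  = tcat s' t \oc (reorder G b p \om idm (T t)).
Proof.
elim: p => [|i s0 s1 t1 e p IH] /=.
  by rewrite reorder_id tensm1 cmp1m cmpm1.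
rewrite -!cmpA pull_catr (reassoc (esym (tens_idr _ _ _))) IH tens_idr tens_idl.
by rewrite -!cmpA (reassoc (assoc_nat _ _ _)) -!cmpA.
Qed.

Lemma reorder_catl s t t' (p : permute t t') :
  reorder G b (permute_catl s p) \oc tcat s t
  = tcat s t' \oc (idm (T s) \om reorder G b p).
Proof.
elim: s => [|i s IH] /=; first by rewrite lunit_nat.
rewrite cmpm1 -!cmpA (reassoc (esym (tens_idr _ _ _))) IH tens_idr -!cmpA.
by rewrite -assoc_nat tensm1.
Qed.

Lemma reorder_cats0 s : reorder G b (permute_cats0 s) \oc tcat s [::] = runit (T s).
Proof.
elim: s => [|i s IH] /=; first by rewrite lunit_one cmp1m.
by rewrite cmpm1 cmpA -tens_idr IH runit_tens.
Qed.

Lemma pull_mid i s t :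
  pull G b (ins_mid i s t) \oc tcat s (i :: t)
  = (idm _ \om tcat s t) \oc swap _ _ _.
Proof.
elim: s => [|j s IH] /=.
  by rewrite cmp1m lunit_swap.
rewrite -!cmpA (reassoc (esym (tens_idr _ _ _))) IH !tens_idr -!cmpA.
by rewrite (reassoc (swap_nat _ _ _)) -!cmpA swap_hexagon'.
Qed.

Lemma reorder_swap s t :
  reorder G b (permute_swap s t) \oc tcat s t = tcat t s \oc braid (T s) (T t).
Proof.
elim: t => [|j t IH] /=; first by rewrite reorder_cats0 lunit_braid.
rewrite -!cmpA pull_mid (reassoc (esym (tens_idr _ _ _))) IH tens_idr -!cmpA.
by rewrite swap.unlock (reassoc3 (esym (hexagon _ _ _))) -!cmpA isoVK cmpm1.
Qed.

Lemma reorder_catA s t u :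
  reorder G b (permute_catA s t u)
    \oc (tcat (s ++ t) u \oc (tcat s t \om idm (T u)))
  = tcat s (t ++ u) \oc ((idm (T s) \om tcat t u) \oc assoc _ _ _).
Proof.
elim: s => [|i s IH] /=.
  by rewrite reorder_id cmp1m (reassoc (lunit_nat _)) -!cmpA lunit_tens.
rewrite cmpm1 tens_idl -!cmpA (reassoc (assoc_nat _ _ _)) -!cmpA.
rewrite !(reassoc (esym (tens_idr _ _ _))) -!cmpA IH !tens_idr -!cmpA pentagon.
by rewrite -[in RHS]tensm1 [in RHS](reassoc (assoc_nat _ _ _)) -!cmpA.
Qed.

Lemma reorder_ins i s t (e : ins i s t) :
  reorder G b (permute_ins e) \oc pull G b e = idm _
  /\ pull G b e \oc reorder G b (permute_ins e) = idm _.
Proof.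
elim: e => [s1|j s1 t1 e [IH1 IH2]] /=.
  by rewrite reorder_id !tensm1 !cmpm1.
rewrite !tensm1 cmpm1; split.
  rewrite -!cmpA (reassoc (swapK _ _ _)) cmp1m.
  by rewrite -tens_idr IH1 tensm1.
rewrite -!cmpA (reassoc (esym (tens_idr _ _ _))) IH2 tensm1 cmp1m.
by rewrite swapK.
Qed.

(** Undo the extractions one by one, inserting at the head. *)
Lemma reorder_inverse s t (p : permute s t) :
  exists q : permute t s, reorder G b p \oc reorder G b q = idm _.
Proof.
elim: p => [|i s0 s1 t1 e p [q E]]; first by exists permute_nil; rewrite /= cmp1m.
have [r Er] := reorder_cmp G b (permute_cons ins_head q) (permute_ins e).
exists r; rewrite -Er /= cmpm1 -!cmpA.
rewrite (reassoc (proj2 (reorder_ins e))) cmp1m.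
by rewrite -tens_idr E tensm1.
Qed.
End Concatenation.

(** * The element calculus *)

(** The elements of a word are those of its interpretation in sets, with A the free
monoid and M the free module of rank one generated by the naturals: A is the set of
words, and M that of words followed by a generator. *)
Definition elt_gen (c : bool) : Type := if c then seq nat else (seq nat * nat)%type.

Fixpoint elt (w : word bool) : Type :=
  match w with
  | Wone => unit
  | Wgen c => elt_gen c
  | Wten w w' => (elt w * elt w')%type
  end.

(** Left summands label copies of A, right ones copies of M. *)
Definition label : eqType := (nat + nat)%type.

Definition colour (l : label) : bool := if l is inl _ then true else false.

(** The final empty list gives both branches the form of a word followed by a list,
as [eval_word] expects. *)
Definition labels_gen (c : bool) : elt_gen c -> seq label :=
  match c with
  | true => fun l => map inl l ++ [::]
  | false => fun x => map inl x.1 ++ [:: inr x.2]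
  end.

Fixpoint labels (w : word bool) : elt w -> seq label :=
  match w return elt w -> seq label with
  | Wone => fun=> [::]
  | Wgen c => @labels_gen c
  | Wten w w' => fun x => labels x.1 ++ labels x.2
  end.

Definition mul_gen (c : bool) (l : seq nat) : elt_gen c -> elt_gen c :=
  match c with
  | true => fun x => l ++ x
  | false => fun x => (l ++ x.1, x.2)
  end.

(** The generic element of a word, with labels numbered from n. *)
Fixpoint fresh (w : word bool) (n : nat) : elt w :=
  match w return elt w with
  | Wone => tt
  | Wgen true => [:: n]
  | Wgen false => ([::], n)
  | Wten w w' => (fresh w n, fresh w' (n + size (labels (fresh w n))))
  end.

Definition label_val (l : label) : nat := match l with inl n | inr n => n end.

Lemma labels_fresh (w : word bool) (n : nat) :
  map label_val (labels (fresh w n)) = iota n (size (labels (fresh w n))).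
Proof.
elim: w n => [|[]|w IHw w' IHw'] n //=.
by rewrite map_cat size_cat iotaD IHw IHw'.
Qed.

Lemma uniq_fresh (w : word bool) (n : nat) : uniq (labels (fresh w n)).
Proof. by apply: (@map_uniq _ _ label_val); rewrite labels_fresh iota_uniq. Qed.

Section Elements.
Variables (E : sym_mon_cat) (A : alg_data E) (M : mod_data A).
Hypotheses (monA : is_monoid A) (modM : is_module M).

Definition gen_ob (c : bool) : E := if c then alg_ob A else mod_ob M.

Definition gen_act (c : bool) : hom (alg_ob A \ox gen_ob c) (gen_ob c) :=
  match c with true => alg_mul A | false => mod_act M end.

Local Notation "\[ w ]" := (den gen_ob w).
Local Notation T s := (den gen_ob (wlist colour s)).
Local Notation RR p := (reorder gen_ob colour p).

(** Multiplies a word of A into an element x of a left module X. For A acting on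
itself x is the unit, and for M it is a generator. *)
Fixpoint eval_word (X : E) (a : hom (alg_ob A \ox X) X) (s : seq label)
    (x : hom (T s) X) (l : seq nat) : hom (T (map inl l ++ s)) X :=
  match l with
  | [::] => x
  | i :: l => a \oc (idm (alg_ob A) \om eval_word a x l)
  end.

Definition eval_gen (c : bool) : forall x : elt_gen c,
    hom (T (labels_gen x)) (gen_ob c) :=
  match c with
  | true => fun l => @eval_word (alg_ob A) (alg_mul A) [::] (alg_one A) l
  | false => fun x => @eval_word (mod_ob M) (mod_act M) [:: inr x.2]
                        (runit (mod_ob M)) x.1
  end.

Fixpoint eval (w : word bool) : forall x : elt w, hom (T (labels x)) \[w] :=
  match w with
  | Wone => fun=> idm one
  | Wgen c => @eval_gen c
  | Wten w w' => fun x =>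
      (eval x.1 \om eval x.2) \oc bwd (tcat gen_ob colour (labels x.1) (labels x.2))
  end.

(** An element of an object X is a morphism to X from the tensor product of a
list of generators; it need not come from a word. *)
Record elem (X : E) := Elem { lab : seq label; val_elem :> hom (T lab) X }.
Arguments lab {X} e.

Definition pair_elem (X Y : E) (x : elem X) (y : elem Y) : elem (X \ox Y) :=
  Elem ((x \om y) \oc bwd (tcat gen_ob colour (lab x) (lab y))).

Definition one_elem : elem one := @Elem one [::] (idm one).

Definition word_elem (w : word bool) (x : elt w) : elem \[w] := Elem (eval x).

(** The equation is up to a reordering, so that a braiding acts on elements by
exchanging two components. *)
Definition maps (X Y : E) (f : hom X Y) (x : elem X) (y : elem Y) :=
  exists p : permute (lab x) (lab y), f \oc x = y \oc RR p.

Lemma eval_split (w : word bool) (n : nat) :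
  exists r, eval (fresh w n) \oc r = idm \[w].
Proof.
elim: w n => [|[]|w IHw w' IHw'] n /=.
- by exists (idm _); rewrite cmp1m.
- exists (bwd (runit _)).
  by case: monA => _ _ ->; rewrite isoVK.
- by exists (bwd (runit _)); rewrite isoVK.
- have [r Er] := IHw n; have [r' Er'] := IHw' (n + size (labels (fresh w n))).
  exists (tcat gen_ob colour (labels (fresh w n)) _ \oc (r \om r')).
  by rewrite -cmpA isoKr -tensmM Er Er' tensm1.
Qed.

(** A morphism is determined by what it does to elements, since a generic
element has no repeated label and evaluates to a split epimorphism. *)
Lemma maps_unique (w : word bool) (Y : E) (f g : hom \[w] Y) :
  (forall x : elt w, exists y, maps f (word_elem x) y /\ maps g (word_elem x) y) ->
  f = g.
Proof.
move=> H; have [y [[p Ep] [q Eq]]] := H (fresh w 0).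
have [r Er] := eval_split w 0.
rewrite -[f]cmpm1 -[g]cmpm1 -Er !cmpA Ep Eq.
by rewrite (reorder_unique _ _ p q (uniq_fresh w 0)).
Qed.

Section Maps.
Implicit Types X Y Z : E.

Lemma maps_id X (x : elem X) : maps (idm X) x x.
Proof. by exists (permute_id _); rewrite reorder_id cmp1m cmpm1. Qed.

Lemma maps_cmp X Y Z (g : hom Y Z) (f : hom X Y) x y z :
  maps f x y -> maps g y z -> maps (g \oc f) x z.
Proof.
move=> [p Ep] [q Eq]; have [r Er] := reorder_cmp gen_ob colour p q.
by exists r; rewrite -cmpA Ep cmpA Eq -cmpA Er.
Qed.

Lemma maps_bwd X Y (f : iso X Y) x y : maps f x y -> maps (bwd f) y x.
Proof.
move=> [p Ep]; have [q Eq] := reorder_inverse gen_ob colour p.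
exists q; apply: (iso_monic (f := f)).
by rewrite isoVKr cmpA Ep -cmpA Eq cmpm1.
Qed.

Lemma maps_tens X X' Y Y' (f : hom X X') (g : hom Y Y') x y z t :
  maps f x y -> maps g z t -> maps (f \om g) (pair_elem x z) (pair_elem y t).
Proof.
move=> [p Ep] [q Eq]; rewrite /maps /=.
have [r Er] := reorder_cmp gen_ob colour
  (permute_catr (lab z) p) (permute_catl (lab y) q).
exists r; rewrite -Er cmpA -tensmM Ep Eq.
apply: (iso_epic (f := tcat _ _ _ _)); rewrite -!cmpA isoK cmpm1.
rewrite reorder_catr (reassoc (reorder_catl _ _ _ _)) -!cmpA isoKr.
by rewrite -!tensmM !cmpm1 cmp1m.
Qed.

Lemma maps_assoc X Y Z (x : elem X) (y : elem Y) (z : elem Z) :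
  maps (assoc X Y Z) (pair_elem (pair_elem x y) z) (pair_elem x (pair_elem y z)).
Proof.
exists (permute_catA _ _ _) => /=.
apply: (iso_epic (f := tcat _ _ _ _)).
apply: (iso_epic (f := iso_tens (tcat gen_ob colour _ _) (iso_id _))) => /=.
rewrite -!cmpA reorder_catA !isoKr -!tensmM -!cmpA !isoK !cmpm1.
rewrite (reassoc (esym (tensmM _ _ _ _))) -!cmpA isoK !cmpm1.
by rewrite assoc_nat.
Qed.

Lemma maps_lunit X (x : elem X) : maps (lunit X) (pair_elem one_elem x) x.
Proof.
exists (permute_id _) => /=; rewrite reorder_id cmpm1 cmpA lunit_nat.
by rewrite -cmpA isoVK cmpm1.
Qed.

Lemma maps_runit X (x : elem X) : maps (runit X) (pair_elem x one_elem) x.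
Proof.
exists (permute_cats0 _) => /=.
apply: (iso_epic (f := tcat _ _ _ _)).
by rewrite -!cmpA isoK cmpm1 reorder_cats0 runit_nat.
Qed.

Lemma maps_braid X Y (x : elem X) (y : elem Y) :
  maps (braid X Y) (pair_elem x y) (pair_elem y x).
Proof.
exists (permute_swap _ _) => /=.
apply: (iso_epic (f := tcat _ _ _ _)).
by rewrite -!cmpA isoK cmpm1 reorder_swap isoKr braid_nat.
Qed.

Lemma maps_swap X Y Z (x : elem X) (y : elem Y) (z : elem Z) :
  maps (swap X Y Z) (pair_elem x (pair_elem y z)) (pair_elem y (pair_elem x z)).
Proof.
rewrite swap.unlock; apply: maps_cmp (maps_assoc _ _ _).
apply: maps_cmp (maps_tens (maps_braid _ _) (maps_id _)).
exact/maps_bwd/maps_assoc.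
Qed.

Lemma maps_middle_four X Y Z U (x : elem X) (y : elem Y) (z : elem Z) (u : elem U) :
  maps (middle_four X Y Z U) (pair_elem (pair_elem x y) (pair_elem z u))
    (pair_elem (pair_elem x z) (pair_elem y u)).
Proof.
apply: maps_cmp (maps_assoc _ _ _) _.
apply: maps_cmp; last exact/maps_bwd/maps_assoc.
apply/maps_tens; first exact: maps_id.
apply: maps_cmp; first exact/maps_bwd/maps_assoc.
by apply: maps_cmp (maps_tens (maps_braid _ _) (maps_id _)) (maps_assoc _ _ _).
Qed.
End Maps.

(** For A acting on A or on M: evaluation turns concatenation into the action, by
induction with the module law. *)
Lemma eval_word_cat (X : E) (a : hom (alg_ob A \ox X) X) (s : seq label)
    (x : hom (T s) X) (l l' : seq nat) :
  a \oc (alg_mul A \om idm X) = a \oc (idm _ \om a) \oc assoc _ _ _ ->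
  a \oc (alg_one A \om idm X) = lunit X ->
  exists p : permute _ _,
    a \oc (@eval_word _ (alg_mul A) [::] (alg_one A) l \om eval_word a x l')
    = eval_word a x (l ++ l') \oc (RR p \oc tcat gen_ob colour _ _).
Proof.
move=> aM a1; elim: l => [|i l [p IH]] /=.
  exists (permute_id _); rewrite reorder_id cmp1m tens_lr cmpA a1.
  by rewrite lunit_nat.
exists (permute_cons ins_head p) => /=.
rewrite cmpm1 tens_lr tens_idl -!cmpA (reassoc aM) -!cmpA -tensmM cmp1m cmpm1.
by rewrite assoc_nat !(reassoc (esym (tens_idr _ _ _))) IH -!cmpA.
Qed.

Lemma maps_act (c : bool) (l : seq nat) (x : elt_gen c) :
  maps (gen_act c) (pair_elem (@word_elem (Wgen true) l) (@word_elem (Wgen c) x))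
    (@word_elem (Wgen c) (mul_gen l x)).
Proof.
case: monA modM => mA m1 _ [nA n1].
case: c x => [l'|[l' m]].
  have [p Ep] := @eval_word_cat _ (alg_mul A) [::] (alg_one A) l l' mA m1.
  by exists p; rewrite /= cmpA Ep -!cmpA isoVK cmpm1.
have [p Ep] := @eval_word_cat _ (mod_act M) [:: inr m] (runit _) l l' nA n1.
by exists p; rewrite /= cmpA Ep -!cmpA isoVK cmpm1.
Qed.

Lemma maps_alg_one : maps (alg_one A) one_elem (@word_elem (Wgen true) [::]).
Proof. by exists permute_nil. Qed.

End Elements.

(** * Multiplying along a partition of a list *)

(** A value is an element of the free monoid on the naturals together with a
generator of the free module; where a point of colour true is concerned only the
first component matters. As the type of values does not depend on the colour,
functions to values can be composed with bijections without any cast. *)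
Definition value := (seq nat * nat)%type.

Definition vone : value := ([::], 0).
Definition vmul (x y : value) : value := (x.1 ++ y.1, y.2).

(** A one-element list is apart because multiplying by [vone] on the right loses the
generator of the module. *)
Fixpoint vprod (I : Type) (h : I -> value) (l : seq I) : value :=
  match l with
  | [::] => vone
  | i :: l => if l is [::] then h i else vmul (h i) (vprod h l)
  end.

Definition restr (c : bool) (x : value) : elt_gen c :=
  match c with true => x.1 | false => x end.

Lemma mul_restr c x y : mul_gen x.1 (restr c y) = restr c (vmul x y).
Proof. by case: c x y => [] [? ?] [? ?]. Qed.

Section Families.
Context {I : eqType} (b : I -> bool).
Implicit Types (s t l : seq I) (h k : I -> value).

(** An element of the tensor product over s, given by a function on the index type. *)
Fixpoint elts h s : elt (wlist b s) :=
  match s with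
  | [::] => tt
  | i :: s => (restr (b i) (h i), elts h s)
  end.

Lemma eq_elts h k s :
  {in s, forall i, restr (b i) (h i) = restr (b i) (k i)} -> elts h s = elts k s.
Proof.
elim: s => [|i s IH] //= hk; rewrite hk ?inE ?eqxx // IH // => j js.
by apply: hk; rewrite inE js orbT.
Qed.

Lemma elts_onto s (x : elt (wlist b s)) : uniq s -> exists h, x = elts h s.
Proof.
elim: s x => [|i s IH] /= x; first by case: x; exists (fun=> vone).
case: x => xi x /andP[nis us]; have [h ->] := IH x us.
have [v ->] : exists v, xi = restr (b i) v.
  by case: (b i) xi => xi; [exists (xi, 0) | exists xi].
exists (fun j => if j == i then v else h j); rewrite eqxx; congr pair.
apply: eq_elts => j js; case: eqP => // ji.
by rewrite -ji js in nis.
Qed.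

(** The lists of colours over which a point of colour c has a multiplication:
only the last colour may be false, and it is that of c. *)
Fixpoint mulable (c : bool) l : bool :=
  match l with
  | [::] => c
  | i :: l => if b i then mulable c l else ~~ c && nilp l
  end.
End Families.

Definition join (I J X : Type) (f : I -> X) (g : J -> X) (z : I + J) : X :=
  match z with inl x => f x | inr y => g y end.

Section Gathering.
Variables (E : sym_mon_cat) (A : alg_data E) (M : mod_data A).
Hypotheses (monA : is_monoid A) (modM : is_module M).

Local Notation den := (den (gen_ob M)).
Local Notation one_elem := (@one_elem E A M).

Section OneFamily.
Context {I : eqType} (b : I -> bool).
Implicit Types (s t l : seq I) (h k : I -> value).

Local Notation T s := (den (wlist b s)).

Definition fam h s : elem M (T s) := word_elem M (elts b h s).
Definition point (c : bool) (x : value) : elem M (gen_ob M c) :=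
  @word_elem E A M (Wgen c) (restr c x).

Lemma maps_pull i s t (e : ins i s t) h :
  maps (pull (gen_ob M) b e) (fam h t) (pair_elem (point (b i) (h i)) (fam h s)).
Proof.
elim: e => [s1|j s1 t1 e IH] /=; first exact: maps_id.
exact (maps_cmp (maps_tens (maps_id (point (b j) (h j))) IH) (maps_swap _ _ _)).
Qed.

Lemma maps_reorder s t (p : permute s t) h :
  maps (reorder (gen_ob M) b p) (fam h s) (fam h t).
Proof.
elim: p => [|i s0 s1 t1 e p IH] /=; first exact: maps_id.
exact (maps_cmp (maps_pull e h) (maps_tens (maps_id _) IH)).
Qed.

Lemma maps_tcat s t h :
  maps (tcat (gen_ob M) b s t) (pair_elem (fam h s) (fam h t)) (fam h (s ++ t)).
Proof.
elim: s => [|i s IH] /=; first exact (maps_lunit (fam h t)).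
exact (maps_cmp (maps_assoc (point (b i) (h i)) _ _) (maps_tens (maps_id _) IH)).
Qed.

Lemma fam_unique s (Y : E) (f g : hom (T s) Y) : uniq s ->
  (forall h, exists y, maps f (fam h s) y /\ maps g (fam h s) y) -> f = g.
Proof.
move=> us H; apply: (maps_unique (M := M) monA) => x.
by have [h ->] := elts_onto x us; apply: H.
Qed.

Lemma iso_reorder s t : uniq s -> perm_eq s t ->
  exists f : iso (T s) (T t), forall h, maps f (fam h s) (fam h t).
Proof.
move=> us st; have ut : uniq t by rewrite -(perm_uniq st).
have [p] := permute_exists st.
have [q] : inhabited (permute t s) by apply: permute_exists; rewrite perm_sym.
have pqK : reorder (gen_ob M) b q \oc reorder (gen_ob M) b p = idm (T s).
  apply: fam_unique => // h; exists (fam h s); split; last exact: maps_id.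
  exact: maps_cmp (maps_reorder _ _) (maps_reorder _ _).
have qpK : reorder (gen_ob M) b p \oc reorder (gen_ob M) b q = idm (T t).
  apply: fam_unique => // h; exists (fam h t); split; last exact: maps_id.
  exact: maps_cmp (maps_reorder _ _) (maps_reorder _ _).
by exists (Iso pqK qpK) => h; apply: maps_reorder.
Qed.

(** The multiplication of a block A ... A or A ... A M. *)
Lemma gather_point c l : mulable b c l ->
  exists f : hom (T l) (gen_ob M c), forall h, maps f (fam h l) (point c (vprod h l)).
Proof.
elim: l => [|i l IH] /=.
  by case: c => // _; exists (alg_one A) => h; apply: maps_alg_one.
move=> bl; suff: exists f : hom (gen_ob M (b i) \ox T l) (gen_ob M c),
  forall h, maps f (pair_elem (point (b i) (h i)) (fam h l))
              (point c (if l is [::] then h i else vmul (h i) (vprod h l))) by [].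
case: (b i) bl => [bl|/andP[]].
  have [f Hf] := IH bl; exists (gen_act M c \oc (idm _ \om f)) => h.
  have -> : point c (if l is [::] then h i else vmul (h i) (vprod h l))
    = @word_elem _ _ M (Wgen c) (mul_gen (h i).1 (restr c (vprod h l))).
    rewrite mul_restr; congr (@word_elem E A M (Wgen c) _).
    by case: l c bl {IH f Hf} => [|j l] [] //= _; rewrite cats0.
  exact (maps_cmp (maps_tens (maps_id (point true (h i))) (Hf h))
           (maps_act monA modM _ _)).
case: c {IH} => // _ /nilP->; exists (runit _) => h.
exact (maps_runit (point false (h i))).
Qed.

Lemma gather_blocks (J : eqType) (b' : J -> bool) (q : J -> seq I) (t : seq J) :
  all (fun j => mulable b (b' j) (q j)) t ->
  exists f : hom (T (flatten (map q t))) (den (wlist b' t)),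
    forall h, maps f (fam h (flatten (map q t)))
                (word_elem M (elts b' (fun j => vprod h (q j)) t)).
Proof.
elim: t => [|j t IH] /=; first by exists (idm _) => h; apply: maps_id.
move=> /andP[/gather_point[f Hf] /IH[g Hg]].
exists ((f \om g) \oc bwd (tcat (gen_ob M) b (q j) (flatten (map q t)))) => h.
exact (maps_cmp (maps_bwd (maps_tcat _ _ h)) (maps_tens (Hf h) (Hg h))).
Qed.

(** All structure maps of the free enrichment but the monoidal ones are instances:
bijections have blocks of length one, units have empty blocks, and a composition
has blocks of length one or two. *)
Lemma gather (J : eqType) (b' : J -> bool) (q : J -> seq I) (s : seq I) (t : seq J) :
  perm_eq s (flatten (map q t)) ->
  all (fun j => mulable b (b' j) (q j)) t ->
  exists f : hom (T s) (den (wlist b' t)),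
    forall h, maps f (fam h s) (word_elem M (elts b' (fun j => vprod h (q j)) t)).
Proof.
move=> /permute_exists[p] /gather_blocks[f Hf].
exists (f \oc reorder (gen_ob M) b p) => h.
exact (maps_cmp (maps_reorder p h) (Hf h)).
Qed.
End OneFamily.

Lemma iso_relabel (I J : eqType) (b : I -> bool) (b' : J -> bool) (r : I -> J)
    (s : seq I) : (forall i, b' (r i) = b i) ->
  exists f : iso (den (wlist b s)) (den (wlist b' (map r s))),
    forall h, maps f (fam b (h \o r) s) (fam b' h (map r s)).
Proof.
move=> br; elim: s => [|i s [f Hf]]; first by exists (iso_id _) => h; apply: maps_id.
suff [g Hg] : exists g : iso (gen_ob M (b i)) (gen_ob M (b' (r i))),
    forall x, maps g (point (b i) x) (point (b' (r i)) x).
  by exists (iso_tens g f) => h; exact (maps_tens (Hg _) (Hf h)).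
by rewrite br; exists (iso_id _) => x; apply: maps_id.
Qed.

(** The monoidal comparison maps, and the first step of a composition. *)
Lemma iso_join (I J : eqType) (b : I -> bool) (b' : J -> bool)
    (b2 : I + J -> bool) (s : seq I) (t : seq J) (u : seq (I + J)%type) :
  (forall i, b2 (inl i) = b i) -> (forall j, b2 (inr j) = b' j) ->
  uniq u -> perm_eq (map inl s ++ map inr t) u ->
  exists f : iso (den (wlist b s) \ox den (wlist b' t)) (den (wlist b2 u)),
    forall h k, maps f (pair_elem (fam b h s) (fam b' k t)) (fam b2 (join h k) u).
Proof.
move=> bl br uu su; have us : uniq (map inl s ++ map inr t) by rewrite (perm_uniq su).
have [f Hf] := @iso_relabel _ _ b b2 inl s bl.
have [g Hg] := @iso_relabel _ _ b' b2 inr t br.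
have [k Hk] := iso_reorder b2 us su.
exists (iso_cmp k (iso_cmp (tcat _ _ _ _) (iso_tens f g))) => x y.
apply: maps_cmp (Hk _).
exact (maps_cmp (maps_tens (Hf (join x y)) (Hg (join x y))) (maps_tcat _ _ _ _)).
Qed.
End Gathering.

(** * Injections *)

Section Injections.
Implicit Types X Y Z : FI_smc.

Lemma fun_id X (x : X) : FI_fun (idm X) x = x.
Proof. exact: FI_idE. Qed.

Lemma fun_cmp X Y Z (g : hom Y Z) (f : hom X Y) (x : X) :
  FI_fun (g \oc f) x = FI_fun g (FI_fun f x).
Proof. exact: FI_cmpE. Qed.

Lemma fun_tens X X' Y Y' (f : hom X X') (g : hom Y Y') (z : X + Y) :
  FI_fun (f \om g) z = sum_map (FI_fun f) (FI_fun g) z.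
Proof. exact: FI_sumE. Qed.

Lemma fun_isoK X Y (s : iso X Y) (x : X) : FI_fun (bwd s) (FI_fun (fwd s) x) = x.
Proof. by rewrite -fun_cmp isoK fun_id. Qed.

Lemma fun_isoVK X Y (s : iso X Y) (y : Y) : FI_fun (fwd s) (FI_fun (bwd s) y) = y.
Proof. by rewrite -fun_cmp isoVK fun_id. Qed.

Definition img X Y (f : hom X Y) (y : Y) : bool := y \in codom (FI_fun f).

Lemma img_fun X Y (f : hom X Y) (x : X) : img f (FI_fun f x).
Proof. exact: codom_f. Qed.

Lemma imgP X Y (f : hom X Y) (y : Y) : reflect (exists x, y = FI_fun f x) (img f y).
Proof. exact: codomP. Qed.

Lemma img_id X (x : X) : img (idm X) x.
Proof. by apply/imgP; exists x; rewrite fun_id. Qed.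

Lemma img_cmp X Y Z (g : hom Y Z) (f : hom X Y) (y : Y) :
  img (g \oc f) (FI_fun g y) = img f y.
Proof.
apply/imgP/imgP => -[x]; last by move=> ->; exists x; rewrite fun_cmp.
by rewrite fun_cmp => /FI_inj; exists x.
Qed.

Lemma img_cmpN X Y Z (g : hom Y Z) (f : hom X Y) (z : Z) :
  ~~ img g z -> img (g \oc f) z = false.
Proof.
by move/imgP=> gz; apply/imgP => -[x e]; apply: gz; exists (FI_fun f x); rewrite -fun_cmp.
Qed.

Lemma img_inl X X' Y Y' (f : hom X X') (g : hom Y Y') (x : X') :
  img (f \om g) (inl x) = img f x.
Proof.
apply/imgP/imgP => -[]; first by case=> z; rewrite fun_tens //= => -[->]; exists z.
by move=> z ->; exists (inl z); rewrite fun_tens.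
Qed.

Lemma img_inr X X' Y Y' (f : hom X X') (g : hom Y Y') (y : Y') :
  img (f \om g) (inr y) = img g y.
Proof.
apply/imgP/imgP => -[]; first by case=> z; rewrite fun_tens //= => -[->]; exists z.
by move=> z ->; exists (inr z); rewrite fun_tens.
Qed.

Lemma img_square (phi psi : arrow FI_smc) (s : square phi psi) (y : tgt phi) :
  img (arr psi) (FI_fun (fwd (sq_tgt s)) y) = img (arr phi) y.
Proof.
apply/imgP/imgP => -[x].
  move=> e; exists (FI_fun (bwd (sq_src s)) x); apply: (@FI_inj _ _ (fwd (sq_tgt s))).
  by rewrite -fun_cmp squareE fun_cmp fun_isoVK.
by move=> ->; exists (FI_fun (fwd (sq_src s)) x); rewrite -!fun_cmp squareE.
Qed.

Definition preimage X Y (f : hom X Y) (y : Y) : option X := [pick x | FI_fun f x == y].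

Lemma preimage_fun X Y (f : hom X Y) (x : X) : preimage f (FI_fun f x) = Some x.
Proof.
rewrite /preimage; case: pickP => [x' /eqP/FI_inj -> //|/(_ x)].
by rewrite eqxx.
Qed.

Lemma preimage_none X Y (f : hom X Y) (y : Y) : ~~ img f y -> preimage f y = None.
Proof.
rewrite /preimage; case: pickP => [x /eqP <-|//].
by rewrite img_fun.
Qed.

Lemma img_ind X Y (f : hom X Y) (P : Y -> Prop) :
  (forall x, P (FI_fun f x)) -> (forall y, ~~ img f y -> P y) -> forall y, P y.
Proof. by move=> Pf PN y; case: (boolP (img f y)) => [/imgP[x ->]|/PN]. Qed.
Lemma uniq_enum_sum (I J : finType) :
  uniq (map inl (enum I) ++ map inr (enum J) : seq (I + J)).
Proof.
have inlI : injective (@inl I J) by move=> ? ? [].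
have inrI : injective (@inr I J) by move=> ? ? [].
rewrite cat_uniq (map_inj_uniq inlI) (map_inj_uniq inrI) !enum_uniq andbT.
by apply/hasPn => _ /mapP[y _ ->]; apply/mapP => -[].
Qed.

Lemma perm_enum_sum (I J : finType) :
  perm_eq (map inl (enum I) ++ map inr (enum J)) (enum {: I + J}).
Proof.
apply: uniq_perm; rewrite ?enum_uniq ?uniq_enum_sum //.
move=> z; rewrite mem_cat [RHS]mem_enum; apply/orP.
by case: z => z; [left|right]; apply/map_f; rewrite mem_enum.
Qed.

Lemma perm_flatten_cons (I : Type) (J : eqType) (f : I -> J) (r : I -> seq J) (s : seq I) :
  perm_eq (map f s ++ flatten (map r s)) (flatten [seq f i :: r i | i <- s]).
Proof.
elim: s => //= i s IH; by rewrite perm_cons perm_catCA perm_cat2l.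
Qed.

End Injections.

(** * The free weak enrichment *)

Section Free.
Variables (E : sym_mon_cat) (A : alg_data E) (M : mod_data A).
Hypotheses (monA : is_monoid A) (modM : is_module M).

Local Notation arrows := (iso_arrow_smc FI_smc).
Local Notation one_elem := (@one_elem E A M).

Implicit Types phi psi chi : arrows.

(** The unordered tensor product over the codomain, with A over the image and M over
its complement, is realized in the order of [enum]. *)
Definition free_ob phi : E :=
  den (gen_ob M) (wlist (img (arr phi)) (enum (tgt phi))).

Definition free_elem phi (h : tgt phi -> value) : elem M (free_ob phi) :=
  fam M (img (arr phi)) h (enum (tgt phi)).

Lemma eq_free_elem phi (h k : tgt phi -> value) :
  (forall y, restr (img (arr phi) y) (h y) = restr (img (arr phi) y) (k y)) ->
  free_elem h = free_elem k.
Proof. by move=> hk; rewrite /free_elem /fam (eq_elts (k := k)) // => y _. Qed.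

Lemma free_map_exists phi psi (s : hom phi psi) :
  exists f : hom (free_ob phi) (free_ob psi), forall h : tgt phi -> value,
    maps f (free_elem h) (free_elem (fun y => h (FI_fun (bwd (sq_tgt s)) y))).
Proof.
pose q y := [:: FI_fun (bwd (sq_tgt s)) y].
have [||f Hf] := @gather _ _ M monA modM _ (img (arr phi)) _ (img (arr psi)) q
  (enum (tgt phi)) (enum (tgt psi)).
- have -> : flatten (map q (enum (tgt psi)))
      = map (FI_fun (bwd (sq_tgt s))) (enum (tgt psi)).
    by elim: (enum _) => //= y t ->.
  apply: uniq_perm; rewrite ?enum_uniq ?(map_inj_uniq (@FI_inj _ _ _)) ?enum_uniq //.
  move=> y; rewrite mem_enum; apply/esym/mapP.
  by exists (FI_fun (fwd (sq_tgt s)) y); rewrite ?mem_enum // fun_isoK.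
- apply/allP => y _ /=; rewrite -(img_square s) fun_isoVK.
  by case: (img _ y).
by exists f => h; apply: Hf.
Qed.

Lemma free_ten_exists phi psi :
  exists f : iso (free_ob phi \ox free_ob psi) (free_ob (phi \ox psi)),
    forall h k, maps f (pair_elem (free_elem h) (free_elem k))
      (@free_elem (phi \ox psi) (join h k)).
Proof.
have [x|y|||f Hf] := @iso_join _ _ M monA _ _ (img (arr phi)) (img (arr psi))
  (img (arr (phi \ox psi))) (enum (tgt phi)) (enum (tgt psi)) (enum (tgt (phi \ox psi))).
- exact: img_inl.
- exact: img_inr.
- exact: enum_uniq.
- exact: perm_enum_sum.
by exists f.
Qed.

Lemma free_one_exists :
  exists f : iso one (free_ob one), forall h : tgt (one : arrows) -> value,
    maps f one_elem (free_elem h).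
Proof.
rewrite /free_elem /free_ob; case: (enum _) => [|[]].
by exists (iso_id _) => h; apply: maps_id.
Qed.

(** The composition on elements: the value of g at a point is multiplied by that of f
at its preimage, if any. *)
Definition act_along (Y Z : FI_smc) (g : hom Y Z) (h : Z -> value) (k : Y -> value)
    (z : Z) : value :=
  if preimage g z is Some y then vmul (h z) (k y) else h z.

Lemma free_comp_exists (X Y Z : FI_smc) (g : hom Y Z) (f : hom X Y) :
  exists c : hom (free_ob (Arrow g) \ox free_ob (Arrow f)) (free_ob (Arrow (g \oc f))),
    forall h k, maps c (pair_elem (@free_elem (Arrow g) h) (@free_elem (Arrow f) k))
      (@free_elem (Arrow (g \oc f)) (act_along g h k)).
Proof.
pose r z : seq (Z + Y) := if preimage g z is Some y then [:: inr y] else [::].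
pose q z := inl z :: r z.
have [||c Hc] := @gather _ _ M monA modM _ (join (img g) (img f)) _ (img (g \oc f)) q
  (map inl (enum Z) ++ map inr (enum Y)) (enum Z).
- rewrite -(permPr (perm_flatten_cons _ _ _)) perm_cat2l.
  have -> : flatten (map r (enum Z)) = map inr (pmap (preimage g) (enum Z)).
    elim: (enum Z) => //= z s ->; rewrite /r.
    by case: (preimage g z).
  apply/perm_map/uniq_perm; rewrite ?enum_uniq //.
    apply: (@pmap_uniq _ _ _ (FI_fun g)); rewrite ?enum_uniq // => z.
    by rewrite /preimage; case: pickP => [y /eqP|].
  move=> y; rewrite mem_enum mem_pmap; apply/esym/mapP.
  by exists (FI_fun g y); rewrite ?mem_enum ?preimage_fun.
- apply/allP => z _; rewrite /q /r.
  elim/(img_ind (f := g)): z => [y|z gz].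
    by rewrite preimage_fun /= img_fun img_cmp; case: (img f y).
  by rewrite preimage_none //= (negPf gz) (img_cmpN _ gz).
have [|j Hj] := @iso_join _ _ M monA _ _ (img g) (img f) (join (img g) (img f))
  (enum Z) (enum Y) (map inl (enum Z) ++ map inr (enum Y)) (fun=> erefl) (fun=> erefl) _
  (perm_refl _).
  exact: uniq_enum_sum.
exists (c \oc j) => h k; apply: (maps_cmp (Hj h k)).
have -> : @free_elem (Arrow (g \oc f)) (act_along g h k)
  = @free_elem (Arrow (g \oc f)) (fun z => vprod (join h k) (q z)).
  apply: eq_free_elem => z; rewrite /act_along /q /r.
  by case: (preimage g z).
exact: Hc.
Qed.

Lemma free_unit_exists (X : FI_smc) :
  exists u : hom one (free_ob (Arrow (idm X))),
    maps u one_elem (@free_elem (Arrow (idm X)) (fun=> vone)).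
Proof.
have [||u Hu] := @gather _ _ M monA modM _ (fun=> true : bool) _ (img (idm X))
  (fun=> [::] : seq void) [::] (enum X).
- by elim: (enum X).
- by apply/allP => x _ /=; rewrite img_id.
by exists u; apply: (Hu (fun=> vone)).
Qed.

Definition free_map phi psi (s : hom phi psi) : hom (free_ob phi) (free_ob psi) :=
  proj1_sig (constructive_indefinite_description _ (free_map_exists s)).

Definition free_ten phi psi : iso (free_ob phi \ox free_ob psi) (free_ob (phi \ox psi)) :=
  proj1_sig (constructive_indefinite_description _ (free_ten_exists phi psi)).

Definition free_one : iso one (free_ob one) :=
  proj1_sig (constructive_indefinite_description _ free_one_exists).

Definition free_comp (X Y Z : FI_smc) (g : hom Y Z) (f : hom X Y) :
    hom (free_ob (Arrow g) \ox free_ob (Arrow f)) (free_ob (Arrow (g \oc f))) :=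
  proj1_sig (constructive_indefinite_description _ (free_comp_exists g f)).

Definition free_unit (X : FI_smc) : hom one (free_ob (Arrow (idm X))) :=
  proj1_sig (constructive_indefinite_description _ (free_unit_exists X)).

Lemma maps_free_map phi psi (s : hom phi psi) (h : tgt phi -> value) :
  maps (free_map s) (free_elem h)
    (free_elem (fun y => h (FI_fun (bwd (sq_tgt s)) y))).
Proof. by rewrite /free_map; case: constructive_indefinite_description. Qed.

Lemma maps_free_ten phi psi (h : tgt phi -> value) (k : tgt psi -> value) :
  maps (free_ten phi psi) (pair_elem (free_elem h) (free_elem k))
    (@free_elem (phi \ox psi) (join h k)).
Proof. by rewrite /free_ten; case: constructive_indefinite_description. Qed.

Lemma maps_free_one : maps free_one one_elem (@free_elem one (fun=> vone)).
Proof. by rewrite /free_one; case: constructive_indefinite_description. Qed.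

Lemma maps_free_comp (X Y Z : FI_smc) (g : hom Y Z) (f : hom X Y) h k :
  maps (free_comp g f) (pair_elem (@free_elem (Arrow g) h) (@free_elem (Arrow f) k))
    (@free_elem (Arrow (g \oc f)) (act_along g h k)).
Proof. by rewrite /free_comp; case: constructive_indefinite_description. Qed.

Lemma maps_free_unit (X : FI_smc) :
  maps (free_unit X) one_elem (@free_elem (Arrow (idm X)) (fun=> vone)).
Proof. by rewrite /free_unit; case: constructive_indefinite_description. Qed.

Definition free_word phi : word bool := wlist (img (arr phi)) (enum (tgt phi)).

Lemma free_elemP phi (x : elt (free_word phi)) :
  exists h : tgt phi -> value, x = elts (img (arr phi)) h (enum (tgt phi)).
Proof. by apply: elts_onto; apply: enum_uniq. Qed.

(** The lemmas below are [maps_unique] for the shapes of the domains that occur in the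
axioms. *)
Definition agree X Y (f g : hom X Y) (x : elem M X) :=
  exists y, maps f x y /\ maps g x y.

Lemma free_unique0 Y (f g : hom one Y) : agree f g one_elem -> f = g.
Proof. by move=> H; apply: (@maps_unique _ _ M monA Wone) => -[]. Qed.

Lemma free_unique1 phi Y (f g : hom (free_ob phi) Y) :
  (forall h : tgt phi -> value, agree f g (free_elem h)) -> f = g.
Proof.
move=> H; apply: (@maps_unique _ _ M monA (free_word phi)) => x.
by have [h ->] := free_elemP x; apply: H.
Qed.

Lemma free_unique2 phi psi Y (f g : hom (free_ob phi \ox free_ob psi) Y) :
  (forall h k, agree f g (pair_elem (@free_elem phi h) (@free_elem psi k))) -> f = g.
Proof.
move=> H; apply: (@maps_unique _ _ M monA (Wten (free_word phi) (free_word psi))).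
move=> [x y].
by have [h ->] := free_elemP x; have [k ->] := free_elemP y; apply: H.
Qed.

Lemma free_unique3 phi psi chi Y
    (f g : hom (free_ob phi \ox free_ob psi \ox free_ob chi) Y) :
  (forall h k l, agree f g
    (pair_elem (pair_elem (@free_elem phi h) (@free_elem psi k)) (@free_elem chi l))) ->
  f = g.
Proof.
move=> H; apply: (@maps_unique _ _ M monA
  (Wten (Wten (free_word phi) (free_word psi)) (free_word chi))) => -[[x y] z].
have [h ->] := free_elemP x; have [k ->] := free_elemP y.
by have [l ->] := free_elemP z; apply: H.
Qed.

Lemma free_unique22 phi psi chi xi Y
    (f g : hom ((free_ob phi \ox free_ob psi) \ox (free_ob chi \ox free_ob xi)) Y) :
  (forall h k l m, agree f g (pair_elem
     (pair_elem (@free_elem phi h) (@free_elem psi k))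
     (pair_elem (@free_elem chi l) (@free_elem xi m)))) -> f = g.
Proof.
move=> H; apply: (@maps_unique _ _ M monA (Wten (Wten (free_word phi) (free_word psi))
  (Wten (free_word chi) (free_word xi)))) => -[[x y] [z t]].
have [h ->] := free_elemP x; have [k ->] := free_elemP y.
by have [l ->] := free_elemP z; have [m ->] := free_elemP t; apply: H.
Qed.

Lemma free_unique00 Y (f g : hom (one \ox one) Y) :
  agree f g (pair_elem one_elem one_elem) -> f = g.
Proof. by move=> H; apply: (@maps_unique _ _ M monA (Wten Wone Wone)) => -[[] []]. Qed.

Lemma free_unique01 phi Y (f g : hom (one \ox free_ob phi) Y) :
  (forall h, agree f g (pair_elem one_elem (@free_elem phi h))) -> f = g.
Proof.
move=> H; apply: (@maps_unique _ _ M monA (Wten Wone (free_word phi))) => -[[] x].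
by have [h ->] := free_elemP x; apply: H.
Qed.

Lemma free_unique10 phi Y (f g : hom (free_ob phi \ox one) Y) :
  (forall h, agree f g (pair_elem (@free_elem phi h) one_elem)) -> f = g.
Proof.
move=> H; apply: (@maps_unique _ _ M monA (Wten (free_word phi) Wone)) => -[x []].
by have [h ->] := free_elemP x; apply: H.
Qed.

Lemma maps_eq X Y (f : hom X Y) (x : elem M X) (y z : elem M Y) :
  maps f x y -> y = z -> maps f x z.
Proof. by move=> ? <-. Qed.

(* Computes the image of an element under a composite of structural maps, by
   following its syntax; the target element is an existential variable. *)
Ltac chase := lazymatch goal with
  | |- maps (_ \oc _) _ _ => eapply maps_cmp; chase
  | |- maps (_ \om _) _ _ => eapply maps_tens; chase
  | |- maps (idm _) _ _ => apply maps_id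
  | |- maps (free_map _) _ _ => apply maps_free_map
  | |- maps (fwd (free_ten _ _)) _ _ => apply maps_free_ten
  | |- maps (fwd free_one) _ _ => apply maps_free_one
  | |- maps (free_comp _ _) _ _ => apply maps_free_comp
  | |- maps (free_unit _) _ _ => apply maps_free_unit
  | |- maps (fwd (assoc _ _ _)) _ _ => apply maps_assoc
  | |- maps (fwd (lunit _)) _ _ => apply maps_lunit
  | |- maps (fwd (runit _)) _ _ => apply maps_runit
  | |- maps (fwd (braid _ _)) _ _ => apply maps_braid
  | |- maps (middle_four _ _ _ _) _ _ => apply maps_middle_four
  end.

Ltac compare := eexists; split; [chase | eapply maps_eq; [chase|]].

Ltac pointwise := apply: eq_free_elem => z; congr (restr _ _).

Definition free_functor : strong_functor arrows E.
Proof.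
apply: (@StrongFunctor _ _ free_ob free_map free_ten free_one).
- move=> phi; apply: free_unique1 => h; compare; pointwise.
  by rewrite fun_id.
- move=> phi psi chi g f; apply: free_unique1 => h; compare; pointwise.
  by rewrite fun_cmp.
- move=> phi phi' psi psi' f g; apply: free_unique2 => h k; compare; pointwise.
  by case: z => z; rewrite fun_tens.
- move=> phi psi chi; apply: free_unique3 => h k l; compare; pointwise.
  by case: z => [|[]] z; rewrite inj_ofE.
- move=> phi; apply: free_unique01 => h; compare; pointwise.
  by rewrite inj_ofE.
- move=> phi; apply: free_unique10 => h; compare; pointwise.
  by rewrite inj_ofE.
- move=> phi psi; apply: free_unique2 => h k; compare; pointwise.
  by case: z => z; rewrite inj_ofE.
Defined.

Local Notation D := free_functor.

Lemma maps_free_cast (X Y : FI_smc) (f g : hom X Y) (e : f = g) h :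
  maps (castD D e) (@free_elem (Arrow f) h) (@free_elem (Arrow g) h).
Proof.
apply: maps_eq; first exact: maps_free_map.
by pointwise; rewrite fun_id.
Qed.

Lemma maps_free_square (X Y X' Y' : FI_smc) (f : hom X Y) (f' : hom X' Y')
    (s : iso X X') (s' : iso Y Y') (e : s' \oc f = f' \oc s) h :
  maps (fmapD D e) (@free_elem (Arrow f) h)
    (@free_elem (Arrow f') (fun y => h (FI_fun (bwd s') y))).
Proof. exact: maps_free_map. Qed.

Lemma maps_free_tenD (X Y X' Y' : FI_smc) (f : hom X Y) (f' : hom X' Y') h k :
  maps (tenD D f f') (pair_elem (@free_elem (Arrow f) h) (@free_elem (Arrow f') k))
    (@free_elem (Arrow (f \om f')) (join h k)).
Proof. exact: maps_free_ten. Qed.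

Ltac chaseD := lazymatch goal with
  | |- maps (castD _ _) _ _ => apply maps_free_cast
  | |- maps (fmapD _ _) _ _ => apply maps_free_square
  | |- maps (tenD _ _ _) _ _ => apply maps_free_tenD
  | |- maps (fwd (fone _)) _ _ => apply maps_free_one
  | |- maps (_ \oc _) _ _ => eapply maps_cmp; chaseD
  | |- maps (_ \om _) _ _ => eapply maps_tens; chaseD
  | |- _ => chase
  end.

Ltac compareD := eexists; split; [chaseD | eapply maps_eq; [chaseD|]].

Lemma act_fun (Y Z : FI_smc) (g : hom Y Z) h k (y : Y) :
  act_along g h k (FI_fun g y) = vmul (h (FI_fun g y)) (k y).
Proof. by rewrite /act_along preimage_fun. Qed.

Lemma act_none (Y Z : FI_smc) (g : hom Y Z) h k (z : Z) :
  ~~ img g z -> act_along g h k z = h z.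
Proof. by rewrite /act_along => /preimage_none ->. Qed.

Lemma act_id (X : FI_smc) h k (x : X) : act_along (idm X) h k x = vmul (h x) (k x).
Proof. by rewrite -{1}(fun_id x) act_fun fun_id. Qed.

(** Associativity, separately over the image of g f, the rest of that of g, and its
complement. *)
Lemma act_cmp (X Y Z : FI_smc) (g : hom Y Z) (f : hom X Y) h k l (z : Z) :
  act_along (g \oc f) (act_along g h k) l z = act_along g h (act_along f k l) z.
Proof.
elim/(img_ind (f := g)): z => [y|z gz]; last first.
  by rewrite !act_none // img_cmpN.
elim/(img_ind (f := f)): y => [x|y fy]; last first.
  by rewrite act_none ?img_cmp // !act_fun act_none.
by rewrite -[in LHS]fun_cmp !act_fun fun_cmp !act_fun /vmul /= catA.
Qed.

Lemma free_comp_associative : comp_associative (D := D) free_comp.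
Proof.
move=> X Y Z W h g f; apply: free_unique3 => k l m; compareD; pointwise.
by rewrite act_cmp.
Qed.

Lemma free_comp_natural : comp_natural (D := D) free_comp.
Proof.
move=> X Y Z X' Y' Z' g f g' f' s s' s'' ef eg.
apply: free_unique2 => h k; compareD; pointwise.
have eg' y : FI_fun (bwd s'') (FI_fun g' y) = FI_fun g (FI_fun (bwd s') y).
  apply: (@FI_inj _ _ (fwd s'')).
  by rewrite fun_isoVK -[RHS]fun_cmp eg fun_cmp fun_isoVK.
elim/(img_ind (f := g')): z => [y|z gz]; first by rewrite act_fun eg' act_fun.
rewrite !act_none //; apply: contra gz => /imgP[y e]; apply/imgP.
by exists (FI_fun (fwd s') y); rewrite -fun_cmp -eg fun_cmp -e fun_isoVK.
Qed.

Lemma free_comp_monoidal : comp_monoidal (D := D) free_comp.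
Proof.
move=> X Y Z X' Y' Z' g f g' f'.
apply: free_unique22 => h k l m; compareD; pointwise.
case: z => z /=.
  elim/(img_ind (f := g)): z => [y|z gz]; last by rewrite !act_none ?img_inl.
  have -> : inl (FI_fun g y) = FI_fun (g \om g') (inl y) by rewrite fun_tens.
  by rewrite !act_fun fun_tens.
elim/(img_ind (f := g')): z => [y|z gz]; last by rewrite !act_none ?img_inr.
have -> : inr (FI_fun g' y) = FI_fun (g \om g') (inr y) by rewrite fun_tens.
by rewrite !act_fun fun_tens.
Qed.

Lemma free_comp_monoidal_one : comp_monoidal_one (D := D) free_comp.
Proof.
apply: free_unique00; compareD.
by apply: eq_free_elem => -[].
Qed.

Lemma free_unit_natural : unit_natural (D := D) free_unit.
Proof.
by move=> X Y s; apply: free_unique0; compareD; pointwise.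
Qed.

Lemma free_unit_monoidal : unit_monoidal (D := D) free_unit.
Proof.
by move=> X Y; apply: free_unique00; compareD; pointwise; case: z.
Qed.

Lemma free_unit_monoidal_one : unit_monoidal_one (D := D) free_unit.
Proof.
by apply: free_unique0; compareD; apply: eq_free_elem => -[].
Qed.

Lemma free_unit_left : unit_left (D := D) free_comp free_unit.
Proof.
move=> X Y f; apply: free_unique01 => h; compareD; pointwise.
by rewrite act_id; case: (h z).
Qed.

(** Multiplying by [vone] on the right changes only the second component of a value,
and this is dropped over the image; over the complement nothing is multiplied. *)
Lemma free_unit_right : unit_right (D := D) free_comp free_unit.
Proof.
move=> X Y f; apply: free_unique10 => h; compareD; apply: eq_free_elem => y /=.
elim/(img_ind (f := f)): y => [x|y fy]; last by rewrite act_none.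
by rewrite img_fun act_fun /= cats0.
Qed.

Definition free_enrichment : weak_enrichment FI_smc E :=
  WeakEnrichment free_comp_associative free_comp_natural free_comp_monoidal
    free_comp_monoidal_one free_unit_natural free_unit_monoidal
    free_unit_monoidal_one free_unit_left free_unit_right.

(** Over the point the free enrichment gives back A and M. *)
Lemma free_point (phi : arrows) (y : tgt phi) (c : bool) :
  enum (tgt phi) = [:: y] -> img (arr phi) y = c ->
  exists f : iso (free_ob phi) (gen_ob M c),
    forall h, maps f (free_elem h) (point M c (h y)).
Proof.
rewrite /free_elem /free_ob => -> <-; exists (runit _) => h.
exact (maps_runit (point M _ (h y))).
Qed.
End Free.

(** * Decomposing injections *)

Section Decomposition.
Implicit Types X Y Z : FI_smc.

Lemma iso_of_bijection X Y (f : X -> Y) :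
  injective f -> (forall y, exists x, f x = y) ->
  exists s : iso X Y, forall x, FI_fun (fwd s) x = f x.
Proof.
move=> fI /fin_all_exists[g gK].
have fK : cancel f g by move=> x; apply: fI; rewrite gK.
by exists (FI_iso fK gK) => x; rewrite inj_ofE.
Qed.

Lemma iso_empty X : (X -> False) -> exists s : iso X one, True.
Proof.
move=> X0; have [||s _] := @iso_of_bijection X one (fun x => False_rect _ (X0 x)).
- by move=> x; case: (X0 x).
- by case.
- by exists s.
Qed.

Lemma iso_singleton X (x0 : X) : (forall x, x = x0) -> exists s : iso X pt, True.
Proof.
move=> Xx0; have [||s _] := @iso_of_bijection X pt (fun=> tt).
- by move=> x y _; rewrite (Xx0 x) (Xx0 y).
- by case; exists x0.
- by exists s.
Qed.

Lemma hom_to_pt X (f g : hom X pt) : f = g.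
Proof. by apply: FI_eq => x; case: (FI_fun f x) (FI_fun g x) => [] []. Qed.

Lemma hom_from_one X (f g : hom one X) : f = g.
Proof. by apply: FI_eq => -[]. Qed.

(** Subsets as objects: cutting Z in two cuts every injection into Z. *)
Definition part X (p : X -> bool) : FI_smc := {x : X | p x} : finType.

Lemma iso_part X (p : X -> bool) :
  exists s : iso (part p \ox part (fun x => ~~ p x)) X,
    forall z, FI_fun (fwd s) z = join val val z.
Proof.
apply: iso_of_bijection => [|x].
  case=> [[x px]|[x px]] [[y py]|[y py]] //= e.
  - by congr inl; apply: val_inj.
  - by exfalso; move: py; rewrite -e px.
  - by exfalso; move: (px); rewrite e py.
  - by congr inr; apply: val_inj.
case: (boolP (p x)) => px; first by exists (inl (exist _ x px)).
by exists (inr (exist _ x px)).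
Qed.

Lemma part_map_inj Y Z (g : hom Y Z) (p : Z -> bool) :
  injective (fun y : part (fun y => p (FI_fun g y)) =>
    exist p (FI_fun g (val y)) (valP y) : part p).
Proof. by move=> y y' [/FI_inj e]; apply: val_inj. Qed.

Definition part_map Y Z (g : hom Y Z) (p : Z -> bool) :
  hom (part (fun y => p (FI_fun g y))) (part p) := inj_of (@part_map_inj Y Z g p).

Lemma val_part_map Y Z (g : hom Y Z) (p : Z -> bool) y :
  val (FI_fun (part_map g p) y) = FI_fun g (val y).
Proof. by rewrite inj_ofE. Qed.

Lemma iso_part_square Y Z (g : hom Y Z) (p : Z -> bool)
    (s : iso (part (fun y => p (FI_fun g y)) \ox part (fun y => ~~ p (FI_fun g y))) Y)
    (s' : iso (part p \ox part (fun z => ~~ p z)) Z) :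
  (forall z, FI_fun (fwd s) z = join val val z) ->
  (forall z, FI_fun (fwd s') z = join val val z) ->
  s' \oc (part_map g p \om part_map g (fun z => ~~ p z)) = g \oc s.
Proof.
move=> sE s'E; apply: FI_eq => z; rewrite !fun_cmp s'E fun_tens sE.
by case: z => z /=; rewrite val_part_map.
Qed.

(** Every composable pair of injections is, up to isomorphism, a disjoint union
of pairs whose codomain is a point: its fibres. There are three of these, since
the middle set is at most a point and so is the domain. *)
Lemma composable_pair_ind
    (P : forall X Y Z : FI_smc, hom Y Z -> hom X Y -> Prop) :
  (forall (X Y Z X' Y' Z' : FI_smc) (g : hom Y Z) (f : hom X Y) (g' : hom Y' Z')
     (f' : hom X' Y') (s : iso X X') (s' : iso Y Y') (s'' : iso Z Z'),
     s' \oc f = f' \oc s -> s'' \oc g = g' \oc s' -> P X Y Z g f -> P X' Y' Z' g' f') ->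
  (forall (X Y Z X' Y' Z' : FI_smc) (g : hom Y Z) (f : hom X Y) (g' : hom Y' Z')
     (f' : hom X' Y'), P X Y Z g f -> P X' Y' Z' g' f' ->
     P (X \ox X') (Y \ox Y') (Z \ox Z') (g \om g') (f \om f')) ->
  P one one one (idm one) (idm one) -> P pt pt pt (idm pt) (idm pt) ->
  P one pt pt (idm pt) from_empty -> P one one pt from_empty (idm one) ->
  forall (X Y Z : FI_smc) (g : hom Y Z) (f : hom X Y), P X Y Z g f.
Proof.
move=> Piso Pten P0 P11 P01 P00.
have Ppoint (X Y Z : FI_smc) (g : hom Y Z) (f : hom X Y) (z0 : Z) :
    (forall z, z = z0) -> P X Y Z g f.
  move=> Zz0; have [s'' _] := iso_singleton Zz0.
  case: (pickP (fun _ : Y => true)) => [y0 _|Y0].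
    have [|s' _] := @iso_singleton Y y0.
      by move=> y; apply: (@FI_inj _ _ g); rewrite [LHS]Zz0 [RHS]Zz0.
    case: (pickP (fun _ : X => true)) => [x0 _|X0].
      have [|s _] := @iso_singleton X x0.
        move=> x; apply: (@FI_inj _ _ f); apply: (@FI_inj _ _ g).
        by rewrite [LHS]Zz0 [RHS]Zz0.
      apply: (Piso _ _ _ _ _ _ (idm pt) (idm pt) _ _ (iso_inv s) (iso_inv s') (iso_inv s'')).
      - apply: (iso_monic (f := s')); exact: hom_to_pt.
      - apply: (iso_monic (f := s'')); exact: hom_to_pt.
      - exact: P11.
    have [|s _] := @iso_empty X; first by move=> x; have := X0 x.
    apply: (Piso _ _ _ _ _ _ (idm pt) from_empty _ _ (iso_inv s) (iso_inv s') (iso_inv s'')).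
    - apply: (iso_monic (f := s')); exact: hom_to_pt.
    - apply: (iso_monic (f := s'')); exact: hom_to_pt.
    - exact: P01.
  have [|s' _] := @iso_empty Y; first by move=> y; have := Y0 y.
  have [|s _] := @iso_empty X; first by move=> x; have := Y0 (FI_fun f x).
  apply: (Piso _ _ _ _ _ _ from_empty (idm one) _ _ (iso_inv s) (iso_inv s') (iso_inv s'')).
  - apply: hom_from_one.
  - apply: hom_from_one.
  - exact: P00.
move=> X Y Z g f; have [n] := ubnP #|Z|.
elim: n X Y Z g f => // n IH X Y Z g f; rewrite ltnS => Zn.
case: (pickP (fun _ : Z => true)) => [z0 _|Z0].
  pose p (z : Z) := z == z0.
  have [s sE] := iso_part (fun x => p (FI_fun g (FI_fun f x))).
  have [s' s'E] := iso_part (fun y => p (FI_fun g y)).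
  have [s'' s''E] := iso_part p.
  apply: (Piso _ _ _ _ _ _ (part_map g p \om part_map g (fun z => ~~ p z))
    (part_map f (fun y => p (FI_fun g y)) \om part_map f (fun y => ~~ p (FI_fun g y)))
    _ _ s s' s'').
  - exact: (@iso_part_square _ _ f (fun y => p (FI_fun g y))).
  - exact: iso_part_square.
  apply: Pten.
    apply: (Ppoint _ _ _ _ _ (exist p z0 (eqxx z0))) => -[z zz0].
    by apply: val_inj; apply/eqP.
  apply: IH; apply: leq_trans Zn; rewrite card_sig.
  rewrite [X in _ < X](cardD1 z0) inE add1n ltnS; apply: subset_leq_card.
  by apply/subsetP => z; rewrite !inE /p => ->.
have Zone : Z -> False by move=> z; have := Z0 z.
have [s'' _] := iso_empty Zone.
have [|s' _] := @iso_empty Y; first by move=> y; apply/Zone/(FI_fun g y).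
have [|s _] := @iso_empty X; first by move=> x; apply/Zone/(FI_fun g (FI_fun f x)).
apply: (Piso _ _ _ _ _ _ (idm one) (idm one) _ _ (iso_inv s) (iso_inv s') (iso_inv s'')).
- exact: hom_from_one.
- exact: hom_from_one.
- exact: P0.
Qed.

Lemma iso_split X X' Y Y' (s : iso (X \ox X') (Y \ox Y')) :
  (forall x, exists y, FI_fun (fwd s) (inl x) = inl y) ->
  (forall x, exists y, FI_fun (fwd s) (inr x) = inr y) ->
  exists (t : iso X Y) (t' : iso X' Y'), forall z,
    FI_fun (fwd s) z = sum_map (FI_fun (fwd t)) (FI_fun (fwd t')) z.
Proof.
move=> /fin_all_exists[f Hf] /fin_all_exists[g Hg].
have [||t Ht] := @iso_of_bijection X Y f.
- move=> x y e; have : inl x = inl y :> X + X' by apply: (@FI_inj _ _ (fwd s)); rewrite !Hf e.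
  by case.
- move=> y; case e : (FI_fun (bwd s) (inl y)) => [x|x].
    by exists x; have := fun_isoVK s (inl y); rewrite e Hf => -[].
  by have := fun_isoVK s (inl y); rewrite e Hg.
have [||t' Ht'] := @iso_of_bijection X' Y' g.
- move=> x y e; have : inr x = inr y :> X + X' by apply: (@FI_inj _ _ (fwd s)); rewrite !Hg e.
  by case.
- move=> y; case e : (FI_fun (bwd s) (inr y)) => [x|x].
    by have := fun_isoVK s (inr y); rewrite e Hf.
  by exists x; have := fun_isoVK s (inr y); rewrite e Hg => -[].
by exists t, t' => -[] z /=; rewrite ?Hf ?Ht ?Hg ?Ht'.
Qed.

(** The sources split because the targets do and the two injections respect the
summands. *)
Lemma square_split (phi phi' psi psi' : iso_arrow_smc FI_smc)
    (s : hom (phi \ox phi') (psi \ox psi')) :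
  (forall x, exists y, FI_fun (fwd (sq_tgt s)) (inl x) = inl y) ->
  (forall x, exists y, FI_fun (fwd (sq_tgt s)) (inr x) = inr y) ->
  exists (t : hom phi psi) (t' : hom phi' psi'), s = t \om t'.
Proof.
move=> sl sr; have [t [t' Ht]] := iso_split sl sr.
have E z : FI_fun (fwd (sq_tgt s)) (sum_map (FI_fun (arr phi)) (FI_fun (arr phi')) z)
    = sum_map (FI_fun (arr psi)) (FI_fun (arr psi')) (FI_fun (fwd (sq_src s)) z).
  rewrite -!fun_tens -[LHS]fun_cmp -[RHS]fun_cmp; congr (FI_fun _ z).
  exact (squareE s).
have [||u [u' Hu]] := @iso_split _ _ _ _ (sq_src s).
- move=> x; have := E (inl x); rewrite Ht /=.
  by case: (FI_fun _ (inl x)) => [y|y] // _; exists y.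
- move=> x; have := E (inr x); rewrite Ht /=.
  by case: (FI_fun _ (inr x)) => [y|y] // _; exists y.
have e : t \oc arr phi = arr psi \oc u.
  by apply: FI_eq => x; rewrite !fun_cmp; have := E (inl x); rewrite Ht Hu => -[].
have e' : t' \oc arr phi' = arr psi' \oc u'.
  by apply: FI_eq => x; rewrite !fun_cmp; have := E (inr x); rewrite Ht Hu => -[].
exists (@Square FI_smc phi psi u t e), (@Square FI_smc phi' psi' u' t' e').
by apply: square_eq; apply: FI_eq => z; rewrite fun_tens ?Hu ?Ht.
Qed.
End Decomposition.

(** * Standard arrows *)

Local Notation arrows := (iso_arrow_smc FI_smc).

(** The codomain is written outside the match so that it reduces to the point. *)
Definition gen_arrow (c : bool) : arrows :=
  @Arrow FI_smc (if c then pt else one) pt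
    (match c with true => idm pt | false => from_empty end).

Local Notation std := (den gen_arrow).

(** By induction on the composable pair of phi and an identity. *)
Lemma std_exists (phi : arrows) : exists w (s : hom (std w) phi), True.
Proof.
case: phi => X Y f.
pose P (X Y Z : FI_smc) (g : hom Y Z) (f : hom X Y) :=
  exists w (s : hom (std w) (Arrow g : arrows)), True.
apply: (@composable_pair_ind P _ _ _ _ _ _ X X Y f (idm X)).
- move=> {X Y f} X Y Z X' Y' Z' g f g' f' s s' s'' _ e [w [t _]].
  by exists w, (square_of e \oc t).
- move=> {X Y f} X Y Z X' Y' Z' g f g' f' [w [t _]] [w' [t' _]].
  by exists (Wten w w'), (t \om t').
- by exists Wone, (idm (one : arrows)).
- by exists (Wgen true), (idm (gen_arrow true)).
- by exists (Wgen true), (idm (gen_arrow true)).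
- by exists (Wgen false), (idm (gen_arrow false)).
Qed.

Local Notation T s := (std (wlist id s)).

Lemma fun_swap (X Y Z : arrows) (z : tgt (X \ox (Y \ox Z))) :
  FI_fun (fwd (sq_tgt (swap X Y Z))) z
  = match z with inl x => inr (inl x) | inr (inl y) => inl y
    | inr (inr t) => inr (inr t) end.
Proof.
rewrite swap.unlock.
by case: z => [z|[z|z]]; do ![rewrite /= (FI_cmpE, FI_sumE, FI_idE, inj_ofE)].
Qed.

Lemma fun_square_cmp (X Y Z : arrows) (t : hom Y Z) (s : hom X Y) (y : tgt X) :
  FI_fun (fwd (sq_tgt (t \oc s))) y
  = FI_fun (fwd (sq_tgt t)) (FI_fun (fwd (sq_tgt s)) y).
Proof. exact: fun_cmp. Qed.

Lemma fun_square_tens (X X' Y Y' : arrows) (s : hom X X') (t : hom Y Y')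
    (y : tgt (X \ox Y)) :
  FI_fun (fwd (sq_tgt (s \om t))) y
  = sum_map (FI_fun (fwd (sq_tgt s))) (FI_fun (fwd (sq_tgt t))) y.
Proof. exact: fun_tens. Qed.

(** Any point of the codomain can be extracted to the front. *)
Lemma pull_point (l : seq bool) (y : tgt (T l)) :
  exists c l' (e : ins c l' l), FI_fun (fwd (sq_tgt (pull gen_arrow id e))) y = inl tt.
Proof.
elim: l y => [|c l IH] y; first by case: y.
case: y => y.
  by exists c, l, ins_head; rewrite /= fun_id; case: y.
have [c' [l' [e E]]] := IH y.
exists c', (c :: l'), (ins_tail c e).
have -> : pull gen_arrow id (ins_tail c e)
  = swap _ _ _ \oc (idm (gen_arrow c) \om pull gen_arrow id e) by [].
by rewrite fun_square_cmp fun_square_tens /sum_map E fun_swap.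
Qed.

Lemma img_gen (c : bool) : img (arr (gen_arrow c)) tt = c.
Proof.
case: c; first exact: (@img_id pt tt).
by apply/imgP => -[].
Qed.

Lemma gen_square (c c' : bool) (s : hom (gen_arrow c) (gen_arrow c')) : c = c'.
Proof.
rewrite -(img_gen c) -(img_gen c') -(img_square s tt).
by case: (FI_fun _ _).
Qed.

Lemma gen_square_id (c : bool) (s : hom (gen_arrow c) (gen_arrow c)) : s = idm _.
Proof.
apply: square_eq; last exact: hom_to_pt.
by case: c s => s; [apply: hom_to_pt | apply: hom_from_one].
Qed.

(** * Transporting isomorphisms of pairs to enrichments *)

Section Transport.
Variables (E : sym_mon_cat) (D D' : strong_functor arrows E).

(** The extension of isomorphisms on the generators to all words, by monoidality. *)
Lemma theta_exists (theta_gen : forall c, iso (D (gen_arrow c)) (D' (gen_arrow c))) :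
  exists theta : forall w, iso (D (std w)) (D' (std w)),
  [/\ forall c, theta (Wgen c) = theta_gen c, theta Wone \oc fone D = fone D'
    & forall w w', theta (Wten w w') \oc ften D (std w) (std w')
      = ften D' (std w) (std w') \oc (theta w \om theta w')].
Proof.
exists (fix theta w : iso (D (std w)) (D' (std w)) := match w with
  | Wone => iso_cmp (fone D') (iso_inv (fone D))
  | Wgen c => theta_gen c
  | Wten w w' => iso_cmp (ften D' _ _)
      (iso_cmp (iso_tens (theta w) (theta w')) (iso_inv (ften D _ _)))
  end); split=> [//||w w'] /=; by rewrite -!cmpA isoK cmpm1.
Qed.

Variable theta : forall w, iso (D (std w)) (D' (std w)).
Hypothesis theta_fone : theta Wone \oc fone D = fone D'.
Hypothesis theta_ften : forall w w', theta (Wten w w') \oc ften D (std w) (std w')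
  = ften D' (std w) (std w') \oc (theta w \om theta w').

Definition natural (w w' : word bool) (s : hom (std w) (std w')) :=
  theta w' \oc fmap D s = fmap D' s \oc theta w.

Lemma natural_id w : natural (idm (std w)).
Proof. by rewrite /natural !fmap1 cmp1m cmpm1. Qed.

Lemma natural_cmp w w' w'' (t : hom (std w') (std w'')) (s : hom (std w) (std w')) :
  natural t -> natural s -> natural (t \oc s).
Proof. by rewrite /natural !fmapM => nt ns; rewrite cmpA nt -cmpA ns cmpA. Qed.

Lemma natural_bwd w w' (s : iso (std w) (std w')) :
  natural s -> natural (bwd s).
Proof.
rewrite /natural => ns.
rewrite -[LHS]cmp1m -(fmap1 D' (std w)) -(isoK s) fmapM -!cmpA; congr (_ \oc _).
by rewrite (reassoc (esym ns)) -cmpA -fmapM isoVK fmap1 cmpm1.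
Qed.

Lemma natural_tens w1 w1' w2 w2' (s : hom (std w1) (std w1'))
    (t : hom (std w2) (std w2')) :
  natural s -> natural t -> @natural (Wten w1 w2) (Wten w1' w2') (s \om t).
Proof.
rewrite /natural => ns nt.
apply: (iso_epic (f := ften D (std w1) (std w2))).
rewrite -!cmpA -ften_nat (reassoc (theta_ften _ _)) theta_ften -!cmpA.
by rewrite (reassoc (esym (ften_nat _ _ _))) -!cmpA -!tensmM ns nt.
Qed.

Lemma natural_assoc w1 w2 w3 :
  @natural (Wten (Wten w1 w2) w3) (Wten w1 (Wten w2 w3))
    (assoc (std w1) (std w2) (std w3)).
Proof.
rewrite /natural.
apply: (iso_epic (f := ften D (std (Wten w1 w2)) (std w3))).
apply: (iso_epic (f := iso_tens (ften D (std w1) (std w2)) (iso_id (D (std w3))))).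
rewrite -!cmpA fassoc -!cmpA (reassoc (theta_ften _ (Wten _ _))) -!cmpA.
rewrite (reassoc (theta_ften (Wten _ _) _)) -!cmpA.
rewrite (reassoc (esym (tensmM _ _ _ _))) cmpm1 (theta_ften w2 w3).
rewrite /iso_tens /= -tensmM theta_ften cmpm1.
rewrite tens_cmpr tens_cmpl -!cmpA -assoc_nat.
by rewrite [RHS](reassoc3 (fassoc _ _ _ _)) -!cmpA.
Qed.

Lemma natural_lunit w : @natural (Wten Wone w) w (lunit (std w)).
Proof.
rewrite /natural.
apply: (iso_epic (f := ften D (std Wone) (std w))).
apply: (iso_epic (f := iso_tens (fone D) (iso_id (D (std w))))).
rewrite -!cmpA (reassoc (theta_ften Wone w)) -!cmpA flunit -lunit_nat.
rewrite -tensmM theta_fone cmpm1 [in RHS]tens_lr.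
by rewrite (reassoc3 (flunit _ _)).
Qed.

Lemma natural_runit w : @natural (Wten w Wone) w (runit (std w)).
Proof.
rewrite /natural.
apply: (iso_epic (f := ften D (std w) (std Wone))).
apply: (iso_epic (f := iso_tens (iso_id (D (std w))) (fone D))).
rewrite -!cmpA (reassoc (theta_ften w Wone)) -!cmpA frunit -runit_nat.
rewrite -tensmM theta_fone cmpm1 [in RHS]tens_rl.
by rewrite (reassoc3 (frunit _ _)).
Qed.

Lemma natural_braid w w' : @natural (Wten w w') (Wten w' w) (braid (std w) (std w')).
Proof.
rewrite /natural.
apply: (iso_epic (f := ften D (std w) (std w'))).
rewrite -!cmpA fbraid (reassoc (theta_ften _ _)) theta_ften -!cmpA -braid_nat.
by rewrite (reassoc (fbraid _ _ _)) -!cmpA.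
Qed.

Lemma natural_swap w1 w2 w3 :
  @natural (Wten w1 (Wten w2 w3)) (Wten w2 (Wten w1 w3))
    (swap (std w1) (std w2) (std w3)).
Proof.
rewrite swap.unlock; apply: (@natural_cmp _ (Wten (Wten w2 w1) w3)).
  exact: natural_assoc.
apply: (@natural_cmp _ (Wten (Wten w1 w2) w3)); last exact/natural_bwd/natural_assoc.
exact: natural_tens (natural_braid _ _) (natural_id _).
Qed.

Lemma natural_pull (c : bool) (l l' : seq bool) (e : ins c l l') :
  @natural (wlist id l') (Wten (Wgen c) (wlist id l)) (pull gen_arrow id e).
Proof.
elim: e => [l1|c' l1 l2 e IH] /=; first exact: natural_id.
exact: natural_cmp (natural_swap _ _ _) (natural_tens (natural_id _) IH).
Qed.

Lemma natural_tcat (l l' : seq bool) :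
  @natural (Wten (wlist id l) (wlist id l')) (wlist id (l ++ l'))
    (tcat gen_arrow id l l').
Proof.
elim: l => [|c l IH] /=; first exact: natural_lunit.
exact: natural_cmp (natural_tens (natural_id (Wgen c)) IH) (natural_assoc _ _ _).
Qed.

Lemma natural_normal_form w :
  exists l (s : iso (std w) (T l)), @natural w (wlist id l) s.
Proof.
elim: w => [|c|w [l [s ns]] w' [l' [s' ns']]].
- by exists [::], (iso_id _); apply: natural_id.
- exists [:: c], (iso_inv (runit _)).
  exact: (natural_bwd (natural_runit (Wgen c))).
exists (l ++ l'), (iso_cmp (tcat gen_arrow id l l') (iso_tens s s')).
exact: natural_cmp (natural_tcat _ _) (natural_tens ns ns').
Qed.

Lemma natural_gen c c' (s : hom (gen_arrow c) (gen_arrow c')) :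
  @natural (Wgen c) (Wgen c') s.
Proof.
have cc := gen_square s; subst c'; rewrite (gen_square_id s).
exact: (natural_id (Wgen c)).
Qed.

Lemma natural_cancel w w' w'' (s : iso (std w') (std w'')) (t : hom (std w) (std w')) :
  natural s -> natural (s \oc t) -> natural t.
Proof.
by move=> ns nst; rewrite -[t](isoKr s); apply: natural_cmp (natural_bwd ns) nst.
Qed.

(** Extract the image of the first point to the front of the target. The composite
then respects the first summand, so it is the disjoint union of an automorphism of
a generator, which is trivial, and of an isomorphism between shorter lists. *)
Lemma natural_list (l l' : seq bool) (s : hom (T l) (T l')) :
  @natural (wlist id l) (wlist id l') s.
Proof.
elim: l l' s => [|c l IH] l' s.
  case: l' s => [s|c l' s].
    have -> : s = idm _ by apply: square_eq; apply: hom_from_one.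
    exact: natural_id.
  by case: (FI_fun (bwd (sq_tgt s)) (inl tt)).
have [c' [l1 [e E1]]] := pull_point (FI_fun (fwd (sq_tgt s)) (inl tt)).
pose t : hom (gen_arrow c \ox T l) (gen_arrow c' \ox T l1) :=
  pull gen_arrow id e \oc s.
have t0 : FI_fun (fwd (sq_tgt t)) (inl tt) = inl tt by rewrite /t fun_square_cmp E1.
have [||u [u' tE]] := @square_split _ _ _ _ t.
- by case; exists tt; rewrite t0.
- move=> x; case tx : (FI_fun _ (inr x)) => [[]|y]; last by exists y.
  by rewrite -t0 in tx; have := @FI_inj _ _ (fwd (sq_tgt t)) _ _ tx.
apply: (@natural_cancel (wlist id (c :: l)) (wlist id l') (Wten (Wgen c') (wlist id l1))
  (iso_square (pull gen_arrow id e))); first exact: natural_pull.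
have -> : iso_square (pull gen_arrow id e) \oc s = u \om u' by [].
exact: natural_tens (natural_gen u) (IH _ u').
Qed.

(** Any two ways of building an injection from points agree, because every
isomorphism between standard arrows is composed of structural ones. *)
Lemma natural_all w w' (s : hom (std w) (std w')) : natural s.
Proof.
have [l [t nt]] := natural_normal_form w; have [l' [t' nt']] := natural_normal_form w'.
apply: (natural_cancel nt'); rewrite -[s](cmpm1) -(isoK t) !cmpA.
exact: natural_cmp (natural_list _) nt.
Qed.
End Transport.

Section FunctorIso.
Context {C E : sym_mon_cat} (D : strong_functor C E).

Lemma fmap_isoK (x y : C) (f : hom x y) (g : hom y x) :
  g \oc f = idm x -> fmap D g \oc fmap D f = idm (D x).
Proof. by move=> gf; rewrite -fmapM gf fmap1. Qed.

Definition fmap_iso (x y : C) (s : iso x y) : iso (D x) (D y) :=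
  Iso (fmap_isoK (isoK s)) (fmap_isoK (isoVK s)).
End FunctorIso.

(** * The equivalence *)

Section Casts.
Context {E : sym_mon_cat} {D : strong_functor arrows E}.

(** Casts are identities up to an equality of morphisms, so that laws about them hold
by substitution. *)
Lemma castD_id (X Y : FI_smc) (f : hom X Y) (e : f = f) : castD D e = idm _.
Proof.
rewrite /castD -(fmap1 D (Arrow f)); congr (fmap D _).
exact: square_eq.
Qed.

Lemma castD_cmp (X Y : FI_smc) (f g h : hom X Y) (e : f = g) (e' : g = h) :
  castD D e' \oc castD D e = castD D (etrans e e').
Proof. by subst g h; rewrite !castD_id cmp1m. Qed.

Lemma castD_compl (c : comp_data D) (X Y Z : FI_smc) (g g' : hom Y Z) (f : hom X Y)
    (e : g = g') (e' : g \oc f = g' \oc f) :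
  c X Y Z g' f \oc (castD D e \om idm _) = castD D e' \oc c X Y Z g f.
Proof. by subst g'; rewrite !castD_id tensm1 cmp1m cmpm1. Qed.

Lemma castD_compr (c : comp_data D) (X Y Z : FI_smc) (g : hom Y Z) (f f' : hom X Y)
    (e : f = f') (e' : g \oc f = g \oc f') :
  c X Y Z g f' \oc (idm _ \om castD D e) = castD D e' \oc c X Y Z g f.
Proof. by subst f'; rewrite !castD_id tensm1 cmp1m cmpm1. Qed.

Lemma castD_inj (X Y : FI_smc) (f g : hom X Y) (e : f = g) Z
    (h k : hom Z (D (Arrow f))) : castD D e \oc h = castD D e \oc k -> h = k.
Proof. by subst g; rewrite !castD_id !cmp1m. Qed.
End Casts.

Section Pairs.
Context {E : sym_mon_cat}.
Implicit Types D : weak_enrichment FI_smc E.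

(** The composition with the identity of Y makes D(f) a module over D(id_Y). *)
Definition left_act D (X Y : FI_smc) (f : hom X Y) :
    hom (D (Arrow (idm Y)) \ox D (Arrow f)) (D (Arrow f)) :=
  castD D (cmp1m f) \oc we_comp D (idm Y) f.

Lemma left_act_assoc D (X Y : FI_smc) (f : hom X Y) :
  left_act D f \oc (left_act D (idm Y) \om idm _)
  = left_act D f \oc (idm _ \om left_act D f) \oc assoc _ _ _.
Proof.
rewrite /left_act tens_cmpl tens_cmpr -!cmpA.
rewrite (reassoc (castD_compl _ _ (congr1 (cmp^~ f) (cmp1m _)))).
rewrite (reassoc (castD_compr _ _ (congr1 (cmp (idm Y)) (cmp1m f)))) -!cmpA.
have A := we_compA D (idm Y) (idm Y) f; rewrite -!cmpA in A.
rewrite -[in RHS](cmpA (castD D _) (we_comp D _ _)) A !(reassoc (castD_cmp _ _)).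
by congr (castD D _ \oc _); apply: proof_irrelevance.
Qed.

Lemma left_act_unit D (X Y : FI_smc) (f : hom X Y) :
  left_act D f \oc (we_unit D Y \om idm _) = lunit _.
Proof. exact: we_unitl. Qed.

Lemma left_act_unitr D (X : FI_smc) :
  left_act D (idm X) \oc (idm _ \om we_unit D X) = runit _.
Proof.
rewrite -[RHS](we_unitr D (idm X)) /left_act.
by congr (castD D _ \oc _ \oc _); apply: proof_irrelevance.
Qed.

Lemma pair_of_monoid D : is_monoid (pair_alg (pair_of D)).
Proof.
split; [exact: left_act_assoc|exact: left_act_unit|exact: left_act_unitr].
Qed.

Lemma pair_of_module D : is_module (pair_mod (pair_of D)).
Proof. split; [exact: left_act_assoc|exact: left_act_unit]. Qed.

Definition enrichment_pair D : alg_mod E := AlgMod (pair_of_monoid D) (pair_of_module D).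

Lemma equiv_pair_iso D D' :
  we_equiv D D' -> alg_mod_iso (enrichment_pair D) (enrichment_pair D').
Proof.
move=> [theta [nat _ _ comp unit]].
have act (X Y : FI_smc) (f : hom X Y) : theta (Arrow f) \oc left_act D f
    = left_act D' f \oc (theta (Arrow (idm Y)) \om theta (Arrow f)).
  rewrite /left_act /castD (reassoc (nat _ _ _)) -!cmpA; congr (_ \oc _).
  exact: comp.
exists (theta (Arrow (idm pt))), (theta (Arrow from_empty)); split.
- exact: act.
- exact: unit.
- exact: act.
Qed.

(** Transport along any isomorphism from a standard arrow: naturality makes the choice
irrelevant. *)
Lemma theta_extend (D D' : strong_functor arrows E)
    (theta : forall w, iso (D (std w)) (D' (std w))) :
  (forall w w' (s : hom (std w) (std w')),
     theta w' \oc fmap D s = fmap D' s \oc theta w) ->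
  exists t : forall phi, iso (D phi) (D' phi),
    forall w phi (s : hom (std w) phi), t phi \oc fmap D s = fmap D' s \oc theta w.
Proof.
move=> nat; have /(_ _)/constructive_indefinite_description ch := std_exists.
pose w phi := proj1_sig (ch phi).
have /(_ _)/constructive_indefinite_description ch' : forall phi,
    exists s : hom (std (w phi)) phi, True by move=> phi; apply: (proj2_sig (ch phi)).
pose s phi : iso (std (w phi)) phi := iso_square (proj1_sig (ch' phi)).
clearbody s.
exists (fun phi => iso_cmp (fmap_iso D' (s phi))
  (iso_cmp (theta (w phi)) (iso_inv (fmap_iso D (s phi))))) => w' phi t /=.
rewrite -!cmpA -fmapM (nat _ _ (bwd (s phi) \oc t)) cmpA -fmapM.
by rewrite isoVKr.
Qed.

(** Both compatibilities are stable under isomorphisms and disjoint unions of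
composable pairs, so they need only be checked on the generating pairs, where they
are the hypotheses or consequences of the unit laws. *)
Lemma pair_iso_equiv D D' :
  alg_mod_iso (enrichment_pair D) (enrichment_pair D') -> we_equiv D D'.
Proof.
move=> [a [m [aM a1 mM]]].
pose tg c : iso (D (gen_arrow c)) (D' (gen_arrow c)) :=
  match c with true => a | false => m end.
have [theta [tgE t1 tM]] := theta_exists tg.
have nat := natural_all t1 tM.
have [t tE] := theta_extend nat.
exists t.
have tid w : t (std w) = theta w :> hom _ _.
  by have := tE w _ (idm (std w)); rewrite !fmap1 cmpm1 cmp1m.
have tgen c : t (gen_arrow c) = tg c :> hom _ _ by rewrite (tid (Wgen c)) tgE.
have tnat (phi psi : arrows) (s : hom phi psi) :
    t psi \oc fmap D s = fmap D' s \oc t phi.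
  have [w [s0 _]] := std_exists phi.
  apply: (iso_epic (f := fmap_iso D (iso_square s0))) => /=.
  by rewrite -!cmpA -fmapM tE tE fmapM -cmpA.
have tten (phi psi : arrows) :
    t (phi \ox psi) \oc ften D phi psi = ften D' phi psi \oc (t phi \om t psi).
  have [w [s _]] := std_exists phi; have [w' [s' _]] := std_exists psi.
  apply: (iso_epic (f := iso_tens (fmap_iso D (iso_square s)) (fmap_iso D (iso_square s')))).
  rewrite -[fwd (iso_tens _ _)]/(fmap D s \om fmap D s').
  rewrite -!cmpA ften_nat cmpA (tE (Wten w w') _ (s \om s')) -!cmpA tM.
  by rewrite (reassoc (esym (ften_nat _ _ _))) -!cmpA -!tensmM !tE.
have ttenD (X Y X' Y' : FI_smc) (f : hom X Y) (f' : hom X' Y') :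
    t (Arrow (f \om f')) \oc tenD D f f'
    = tenD D' f f' \oc (t (Arrow f) \om t (Arrow f')) by apply: tten.
have tone : t one \oc fone D = fone D' by rewrite (tid Wone).
have tcast (X Y : FI_smc) (f g : hom X Y) (e : f = g) :
    t (Arrow g) \oc castD D e = castD D' e \oc t (Arrow f) by apply: tnat.
have tact (X Y : FI_smc) (f : hom X Y) :
    t (Arrow f) \oc left_act D f = left_act D' f \oc (t (Arrow (idm Y)) \om t (Arrow f)) ->
    t (Arrow (idm Y \oc f)) \oc we_comp D (idm Y) f
    = we_comp D' (idm Y) f \oc (t (Arrow (idm Y)) \om t (Arrow f)).
  move=> tf; apply: (castD_inj (e := cmp1m f)).
  by rewrite cmpA -tcast -cmpA tf /left_act -cmpA.
(* By the unit laws, a composition with the identity of the empty set is the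
   right unitor. *)
have tright (Y : FI_smc) (f : hom one Y) :
    t (Arrow (f \oc idm one)) \oc we_comp D f (idm one)
    = we_comp D' f (idm one) \oc (t (Arrow f) \om t (Arrow (idm one))).
  apply: (castD_inj (e := cmpm1 f)).
  apply: (iso_epic (f := iso_tens (iso_id (D (Arrow f))) (fone D))).
  rewrite -[fwd (iso_tens _ _)]/(idm (D (Arrow f)) \om fone D).
  have u := we_unitr D f; rewrite we_unit_one -cmpA in u.
  have u' := we_unitr D' f; rewrite we_unit_one -cmpA in u'.
  rewrite (cmpA (castD D' _)) -tcast -!cmpA u -tensmM (cmpm1 (fwd (t (Arrow f)))).
  rewrite (tone : t (Arrow (idm one)) \oc fone D = fone D').
  by rewrite tens_rl (reassoc3 u') runit_nat.
split=> // [X Y Z g f|X].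
- apply: (@composable_pair_ind (fun X Y Z g f =>
    t (Arrow (g \oc f)) \oc we_comp D g f
    = we_comp D' g f \oc (t (Arrow g) \om t (Arrow f)))) => {X Y Z g f}.
  + move=> X Y Z X' Y' Z' g f g' f' s s' s'' ef eg tgf.
    pose F := fmap_iso D (iso_square (square_of ef)).
    pose G := fmap_iso D (iso_square (square_of eg)).
    apply: (iso_epic (f := iso_tens G F)).
    rewrite -[fwd (iso_tens G F)]/(fmapD D eg \om fmapD D ef).
    rewrite -!cmpA -(we_comp_nat D ef eg) (reassoc (tnat _ _ _)) -cmpA tgf.
    rewrite (reassoc (we_comp_nat D' ef eg)) -!cmpA -!tensmM.
    by rewrite /fmapD !tnat.
  + move=> X Y Z X' Y' Z' g f g' f' IH IH'.
    pose T := iso_tens (ften D (Arrow g) (Arrow g')) (ften D (Arrow f) (Arrow f')).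
    pose mf := middle_four_iso (D (Arrow g)) (D (Arrow f)) (D (Arrow g')) (D (Arrow f')).
    (* Both sides are compared after the interchange isomorphism of their source. *)
    apply: (castD_inj (e := esym (tensmM g f g' f'))).
    apply: (iso_epic (f := iso_cmp T mf)).
    rewrite -[fwd (iso_cmp T mf)]/((tenD D g g' \om tenD D f f') \oc middle_four _ _ _ _).
    have := middle_four_nat (t (Arrow g)) (t (Arrow f)) (t (Arrow g')) (t (Arrow f')).
    have := we_comp_ten D g f g' f'; have := we_comp_ten D' g f g' f'.
    (* Generalized, so that associativity is not applied inside of them. *)
    move: (middle_four (D _) _ _ _) (middle_four (D' _) _ _ _) => m4 m4' cD' cD m4E.
    rewrite -!cmpA in cD cD'.
    rewrite (cmpA (castD D' _)) -tcast -!cmpA -cD (reassoc (ttenD _ _ _ _ _ _)) -!cmpA.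
    rewrite -tensmM IH IH' (@tensmM E) (reassoc cD') -!(@cmpA E) m4E.
    by rewrite !(reassoc (esym (@tensmM E _ _ _ _ _ _ _ _ _ _))) !ttenD.
  + exact: tright.
  + apply: tact; rewrite (tgen true); exact: aM.
  + apply: tact; rewrite (tgen true) (tgen false); exact: mM.
  + exact: tright.
- apply: (@composable_pair_ind (fun _ _ Z _ _ =>
    t (Arrow (idm Z)) \oc we_unit D Z = we_unit D' Z) _ _ _ _ _ _ X X X (idm X) (idm X)).
  + move=> {}X Y Z X' Y' Z' _ _ _ _ _ _ s _ _ uZ.
    by rewrite -(we_unit_nat D s) (reassoc (tnat _ _ _)) -cmpA uZ (we_unit_nat D' s).
  + move=> {}X Y Z X' Y' Z' _ _ _ _ uZ uZ'.
    apply: (iso_epic (f := lunit one)); rewrite -cmpA.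
    rewrite -(we_unit_ten D) -(we_unit_ten D') -!cmpA (reassoc (tcast _ _ _ _ _)) -!cmpA.
    rewrite (reassoc (ttenD _ _ _ _ _ _)) -!cmpA -tensmM.
    by rewrite uZ uZ'.
  + by rewrite !we_unit_one.
  + by rewrite (tgen true); exact: a1.
  + by rewrite (tgen true); exact: a1.
  + by rewrite (tgen true); exact: a1.
Qed.
End Pairs.

Lemma enum_pt : enum pt = [:: tt].
Proof. by rewrite enumT unlock. Qed.

(** On elements, composing at the point is concatenation, which is what the
multiplication and the action do. *)
Lemma free_pair (E : sym_mon_cat) (P : alg_mod E) :
  alg_mod_iso (enrichment_pair (free_enrichment (am_monoid P) (am_module P))) P.
Proof.
set A := pair_alg P; set M := pair_mod P.
pose monA : is_monoid A := am_monoid P; pose modM : is_module M := am_module P.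
have [a Ha] := @free_point E A M (Arrow (idm pt)) tt true enum_pt (@img_id pt tt).
have [m Hm] := @free_point E A M (Arrow from_empty) tt false enum_pt (img_gen false).
exists a, m; split.
- apply: (free_unique2 monA) => h k.
  exists (point M true (act_along (idm pt) h k tt)); split.
    apply: maps_cmp (Ha _).
    exact (maps_cmp (@maps_free_comp E A M monA modM _ _ _ _ _ h k) (maps_free_cast _ _ _ _)).
  rewrite /point act_id.
  exact (maps_cmp (maps_tens (Ha h) (Ha k)) (@maps_act _ A M monA modM true _ _)).
- apply: (free_unique0 monA); exists (point M true vone); split.
    exact (maps_cmp (maps_free_unit monA modM pt) (Ha _)).
  exact: maps_alg_one.
apply: (free_unique2 monA) => h k.
exists (point M false (act_along (idm pt) h k tt)); split.
  apply: maps_cmp (Hm _).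
  exact (maps_cmp (@maps_free_comp E A M monA modM _ _ _ _ _ h k) (maps_free_cast _ _ _ _)).
rewrite /point act_id.
exact (maps_cmp (maps_tens (Ha h) (Hm k)) (@maps_act _ A M monA modM false _ _)).
Qed.

Theorem proposition4p24 (E : sym_mon_cat) :
  exists Phi : weak_enrichment FI_smc E -> alg_mod E,
  [/\ forall D, am_data (Phi D) = pair_of D,
      forall D D', we_equiv D D' <-> alg_mod_iso (Phi D) (Phi D')
    & forall P : alg_mod E, exists D, alg_mod_iso (Phi D) P].
Proof.
exists (@enrichment_pair E); split=> [//|D D'|P].
  by split; [apply: equiv_pair_iso|apply: pair_iso_equiv].
by exists (free_enrichment (am_monoid P) (am_module P)); apply: free_pair.
Qed.
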